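(* Let $R\subset\mathbb R^n$ be a nonempty strongly eutactic root system of norm $2$ spanning $\mathbb R^n$. For $j\ge1$ consider the condition $(C_{2j})$: $\sum_{x\in R}f(x)=0$ for all $f\in\mathrm{Harm}_{2j}(\mathbb R^n)$. Then (equivalence meaning isometry of root systems): (i) $(C_2)$ always holds (i.e. $R$ is a spherical $3$-design); (ii) $(C_4)$ holds iff $R$ is equivalent to one of $A_1,A_2,D_4,E_6,E_7,E_8$; (iii) $(C_6)$ holds iff $R$ is equivalent to one of $A_1,\ 2A_1,\ E_8,\ 2E_8,\ D_{16}$; (iv) $(C_8)$ holds iff $R$ is equivalent to $A_1$ or $A_2$; (v) $(C_{10})$ holds iff $R$ is equivalent to one of $A_1,\ 2A_1,\ A_2,\ D_4,\ E_8$; (vi) $(C_{12})$ holds iff $R$ is equivalent to $A_1$.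
   Context: A root system is a finite subset $R\subset\mathbb R^n$ not containing $0$, closed under the reflections $s_y$ ($y\in R$), with $2\langle x,y\rangle/\langle x,x\rangle\in\mathbb Z$; norm $2$ means $\langle x,x\rangle=2$ for all $x\in R$. Orthogonal unions and irreducible components are as usual; $kR$ denotes the orthogonal union of $k$ copies of $R$. The Coxeter number of an irreducible root system $R\subset\mathbb R^n$ is $h=|R|/n$; $R$ is strongly eutactic if all irreducible components have the same Coxeter number. $A_n,D_n,E_6,E_7,E_8$ are the standard irreducible simply laced root systems normalized to norm 2 (Coxeter numbers $n+1$, $2(n-1)$, $12$, $18$, $30$). $\mathrm{Harm}_{j}(\mathbb R^n)$ denotes the homogeneous harmonic polynomials of degree $j$ on $\mathbb R^n$. *)

(* Defs.v *)
From HB Require Import structures.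
From mathcomp Require Import all_boot all_order all_algebra.
From mathcomp Require Import reals.
From mathcomp Require Import mpoly.

Set Implicit Arguments.
Unset Strict Implicit.
Unset Printing Implicit Defensive.

Import Order.TTheory GRing.Theory Num.Theory.
Local Open Scope ring_scope.

(* Euclidean space R^n is modelled by row vectors 'rV[R]_n over a realType R.
   A finite subset of R^n is a duplicate-free sequence. *)

Section RootSystems.
Variable R : realType.

Definition dotv {n} (x y : 'rV[R]_n) : R := (x *m y^T) 0 0.

Definition refl {n} (y x : 'rV[R]_n) : 'rV[R]_n :=
  x - ((2 * dotv x y) / dotv y y) *: y.

Definition root_system {n} (Phi : seq 'rV[R]_n) : Prop :=
  [/\ uniq Phi, (0 : 'rV[R]_n) \notin Phi,
      {in Phi &, forall x y, refl y x \in Phi} &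
      {in Phi &, forall x y, (2 * dotv x y) / dotv x x \is a Num.int}].

Definition norm2 {n} (Phi : seq 'rV[R]_n) : Prop :=
  {in Phi, forall x, dotv x x = 2}.

Definition rows_mx {n} (s : seq 'rV[R]_n) : 'M[R]_(size s, n) :=
  \matrix_(i < size s) nth 0 s i.

Definition span_dim {n} (s : seq 'rV[R]_n) : nat := \rank (rows_mx s).

Definition spans {n} (Phi : seq 'rV[R]_n) : Prop := span_dim Phi = n.

(* irreducible components: connected components of the graph on Phi
   whose edges join non-orthogonal roots *)
Definition nonorth {n} : rel 'rV[R]_n := fun x y => dotv x y != 0.

Definition connected_in {n} (Phi : seq 'rV[R]_n) (x y : 'rV[R]_n) : bool :=
  [exists k : 'I_(size Phi).+1,
     [exists t : k.-tuple 'I_(size Phi),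
        let s := [seq nth 0 Phi (val i) | i : 'I_(size Phi) <- t] in
        path nonorth x s && (last x s == y)]].

Definition component {n} (Phi : seq 'rV[R]_n) (x : 'rV[R]_n) : seq 'rV[R]_n :=
  [seq y <- Phi | connected_in Phi x y].

Definition coxeter_number {n} (C : seq 'rV[R]_n) : R :=
  (size C)%:R / (span_dim C)%:R.

Definition strongly_eutactic {n} (Phi : seq 'rV[R]_n) : Prop :=
  {in Phi &, forall x y,
     coxeter_number (component Phi x) = coxeter_number (component Phi y)}.

Definition evalv {n} (p : {mpoly R[n]}) (x : 'rV[R]_n) : R :=
  p.@[fun i => x 0 i].

Definition homogeneous {n} (d : nat) (p : {mpoly R[n]}) : bool :=
  all (fun m => mdeg m == d) (msupp p).

Definition laplacian {n} (p : {mpoly R[n]}) : {mpoly R[n]} :=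
  \sum_(i < n) mderiv i (mderiv i p).

Definition harmonic {n} (d : nat) (p : {mpoly R[n]}) : Prop :=
  homogeneous d p /\ laplacian p = 0.

Definition design_cond {n} (Phi : seq 'rV[R]_n) (d : nat) : Prop :=
  forall p : {mpoly R[n]}, harmonic d p -> \sum_(x <- Phi) evalv p x = 0.

(* equivalence (isometry) of root systems: an isometric linear embedding
   R^n -> R^m (x |-> x *m M with M M^T = 1) mapping Phi onto Psi *)
Definition rs_equiv {n m} (Phi : seq 'rV[R]_n) (Psi : seq 'rV[R]_m) : Prop :=
  exists M : 'M[R]_(n, m),
    M *m M^T = 1%:M /\ Psi =i [seq x *m M | x <- Phi].

Definition ev {n} (i : 'I_n) : 'rV[R]_n := delta_mx 0 i.

Definition rsA (k : nat) : seq 'rV[R]_(k.+1) :=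
  [seq ev p.1 - ev p.2 | p <- enum [pred p : 'I_k.+1 * 'I_k.+1 | p.1 != p.2]].

Definition rsD (k : nat) : seq 'rV[R]_k :=
  flatten [seq [:: ev p.1 + ev p.2; ev p.1 - ev p.2; - ev p.1 + ev p.2;
                   - ev p.1 - ev p.2]
          | p <- enum [pred p : 'I_k * 'I_k | (p.1 < p.2)%N]].

Definition rsE8 : seq 'rV[R]_8 :=
  rsD 8 ++
  [seq \row_i (if s i then - 2^-1 else 2^-1)
   | s : {ffun 'I_8 -> bool} <- enum [pred s : {ffun 'I_8 -> bool} | ~~ odd #|[pred i | s i]|]].

Definition halfones : 'rV[R]_8 := \row_(i < 8) 2^-1.
Definition halfones' : 'rV[R]_8 :=
  \row_(i < 8) (if i == 0 :> nat then - 2^-1 else 2^-1).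

Definition rsE7 : seq 'rV[R]_8 :=
  [seq x <- rsE8 | dotv x halfones == 0].

(* E_6: roots of E_8 orthogonal to the A_2 sub-root-system spanned by the
   two E_8 roots (1/2,...,1/2) and e_0 + e_1 (inner product 1) *)
Definition a2vec : 'rV[R]_8 := ev (0 : 'I_8) + ev (1 : 'I_8).
Definition rsE6 : seq 'rV[R]_8 :=
  [seq x <- rsE8 | (dotv x halfones == 0) && (dotv x a2vec == 0)].

Definition osum {a b} (S : seq 'rV[R]_a) (T : seq 'rV[R]_b) : seq 'rV[R]_(a + b) :=
  [seq row_mx x 0 | x <- S] ++ [seq row_mx 0 y | y <- T].

End RootSystems.

(* Main.v *)
(* When every root has the same number of neighbours at inner product 1, namely
[2h - 4], the sum over the roots of the zonal harmonic of degree [2j] centred at a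
root depends only on [n] and [h].  Since zonal harmonics represent point evaluation
for the Fischer product, which is positive definite, the vanishing of this one number
is equivalent to [(C_2j)].  For each [j] this is a diophantine equation, linear in
[h], whose admissible solutions form a finite list.

It remains to see which pairs [(n, h)] occur.  When [h] is large with respect to [n],
the system contains a [D_4]; a maximal [D_k] above it is either a whole component, so
that [h = 2k - 2], or it is joined by a half-spin root, which yields an [E_6].  A root
outside an [E_6] or [E_7] but not orthogonal to it can be chosen minuscule, and thus
extends it to [E_7] or [E_8]; hence [h] is 12, 18 or 30. *)

From Stdlib Require Import BinInt.
Require Import Defs.
From HB Require Import structures.
From mathcomp Require Import all_boot all_order all_algebra.
From mathcomp Require Import reals.
From mathcomp Require Import mpoly ssrcomplements bigenough.
From mathcomp Require Import ring lra zify ssrZ.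

Set Implicit Arguments.
Unset Strict Implicit.
Unset Printing Implicit Defensive.

Import Order.TTheory GRing.Theory Num.Theory BigEnough.
Local Open Scope ring_scope.

(** * The Fischer product *)

Section Fischer.
Variables (R : comNzRingType) (n : nat).
Implicit Types (p q : {mpoly R[n]}) (a : 'rV[R]_n) (m : 'X_{1..n}).

Definition fischer p q : R := \sum_(m <- msupp p) p@_m * (q^`M[m])@_0.

Lemma fischer_is_linear p : linear_for *%R (fischer p).
Proof.
move=> c q q'; rewrite /fischer mulr_sumr -big_split /=; apply: eq_bigr => m _.
by rewrite linearP /= mcoeffD mcoeffZ mulrDr mulrCA.
Qed.

HB.instance Definition _ p :=
  GRing.isLinear.Build R {mpoly R[n]} R *%R (fischer p) (fischer_is_linear p).

Lemma fischerwE k p q : (msize p <= k)%N ->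
  fischer p q = \sum_(m : 'X_{1..n < k}) p@_m * (q^`M[m])@_0.
Proof.
pose I : subFinType _ := 'X_{1..n < k}.
move=> le_pk; rewrite /fischer (big_mksub I) /=; first last.
- by move=> m /msize_mdeg_lt/leq_trans/(_ le_pk).
- exact: msupp_uniq.
by rewrite big_rmcond //= => m /memN_msupp_eq0 ->; rewrite mul0r.
Qed.
Arguments fischerwE k [p].

Lemma fischer_linear_left q : linear_for *%R (fischer^~ q).
Proof.
move=> c p p'; pose_big_enough k; first rewrite !(fischerwE k) //.
  rewrite mulr_sumr -big_split /=; apply/eq_bigr => m _.
  by rewrite mcoeffD mcoeffZ mulrDl mulrA.
by close.
Qed.

Lemma fischer0l q : fischer 0 q = 0.
Proof. by rewrite /fischer msupp0 big_nil. Qed.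

Lemma fischerDl p p' q : fischer (p + p') q = fischer p q + fischer p' q.
Proof. by rewrite -[p]scale1r fischer_linear_left mul1r scale1r. Qed.

Lemma fischerZl c p q : fischer (c *: p) q = c * fischer p q.
Proof. by rewrite -[c *: p]addr0 fischer_linear_left fischer0l addr0. Qed.

Lemma fischer_suml (I : Type) (r : seq I) (F : I -> {mpoly R[n]}) q :
  fischer (\sum_(i <- r) F i) q = \sum_(i <- r) fischer (F i) q.
Proof.
by elim: r => [|i r IHr]; rewrite ?big_nil ?fischer0l // !big_cons fischerDl IHr.
Qed.

Lemma fischerX m q : fischer 'X_[m] q = (q^`M[m])@_0.
Proof. by rewrite /fischer msuppX big_seq1 mcoeffX eqxx mul1r. Qed.

Lemma fischer_mulX i p q : fischer ('X_i * p) q = fischer p (q^`M(i)).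
Proof.
elim/mpolyind: p => [|c m p _ _ IHp]; first by rewrite mulr0 !fischer0l.
rewrite mulrDr -scalerAr !fischerDl !fischerZl IHp -mpolyXD !fischerX.
by rewrite mderivmDm mderivmU1m.
Qed.

(* Multiplication by a variable is adjoint to the derivation along it; hence
   [linform a ^+ d] represents evaluation at [a] in degree [d], and [qform] is
   adjoint to the Laplacian. *)
Definition linform a : {mpoly R[n]} := \sum_i a 0 i *: 'X_i.
Definition qform : {mpoly R[n]} := \sum_i 'X_i ^+ 2.
Definition dirderiv a q : {mpoly R[n]} := \sum_i a 0 i *: q^`M(i).

Lemma fischer_mul_linform a p q : fischer (linform a * p) q = fischer p (dirderiv a q).
Proof.
rewrite mulr_suml fischer_suml [RHS]raddf_sum /=; apply: eq_bigr => i _.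
by rewrite -scalerAl fischerZl linearZ /= fischer_mulX.
Qed.

Lemma mderiv_homog d i p : p \is d.+1.-homog -> p^`M(i) \is d.-homog.
Proof.
move=> hp; apply/dhomogP => m; rewrite mcoeff_msupp mcoeff_mderiv.
apply: contraNeq => m_neq_d; rewrite (dhomog_nemf_coeff hp) ?mul0rn //.
by rewrite /= mdegD mdeg1 addn1 eqSS.
Qed.

Lemma dirderiv_homog d a p : p \is d.+1.-homog -> dirderiv a p \is d.-homog.
Proof.
by move=> hp; apply: rpred_sum => i _; apply: rpredZ; apply: mderiv_homog.
Qed.

Lemma mulX_mderivX i m : 'X_i * ('X_[m])^`M(i) = (m i)%:R *: 'X_[m] :> {mpoly R[n]}.
Proof.
rewrite mderivX -scalerAr -mpolyXD; have [->|mi] := posnP (m i).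
  by rewrite !scale0r.
by rewrite addmC submK // lep1mP -lt0n.
Qed.

Lemma euler_identity d p : p \is d.-homog -> \sum_i 'X_i * p^`M(i) = d%:R *: p.
Proof.
move=> hp; rewrite [in RHS](mpolyE p) scaler_sumr.
under eq_bigr => i _ do rewrite [in X in _ * X](mpolyE p) raddf_sum /= mulr_sumr.
rewrite exchange_big; apply: eq_big_seq => m /(dhomog_mf hp) <-.
under eq_bigr => i _ do rewrite mderivZ -scalerAr mulX_mderivX scalerA mulrC.
by rewrite -scaler_suml -mulr_suml -natr_sum -mdegE scalerA.
Qed.

Lemma meval_dirderiv d a p : p \is d.-homog ->
  (dirderiv a p).@[a 0] = d%:R * p.@[a 0].
Proof.
move=> /euler_identity /(congr1 (meval (a 0))); rewrite mevalZ => <-.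
rewrite !raddf_sum /=; apply: eq_bigr => i _.
by rewrite mevalZ mevalM mevalXU.
Qed.

Lemma fischer_linformX d a p : p \is d.-homog ->
  fischer (linform a ^+ d) p = d`!%:R * p.@[a 0].
Proof.
elim: d p => [|d IHd] p hp.
  rewrite expr0 -mpolyX0 fischerX mderivm0m fact0 mul1r.
  suff -> : p = (p@_0)%:MP by rewrite mevalC mcoeffC eqxx mulr1.
  apply/mpolyP => m; rewrite mcoeffC.
  have [<-|m_neq0] := eqVneq 0%MM m; first by rewrite mulr1.
  by rewrite mulr0 (dhomog_nemf_coeff hp) // mdeg_eq0 eq_sym.
rewrite exprS fischer_mul_linform IHd; last exact: dirderiv_homog.
by rewrite (meval_dirderiv a hp) factS natrM mulrA (mulrC _%:R d.+1%:R).
Qed.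

Lemma linform_homog a : linform a \is 1.-homog.
Proof. by apply: rpred_sum => i _; apply: rpredZ; rewrite dhomogX /= mdeg1. Qed.

Lemma qform_homog : qform \is 2.-homog.
Proof.
by apply: rpred_sum => i _; rewrite -[2%N]/(1 * 2)%N dhomogMn // dhomogX /= mdeg1.
Qed.

Lemma meval_linform a (v : 'I_n -> R) : (linform a).@[v] = \sum_i a 0 i * v i.
Proof. by rewrite raddf_sum /=; apply: eq_bigr => i _; rewrite mevalZ mevalXU. Qed.

Lemma meval_qform (v : 'I_n -> R) : qform.@[v] = \sum_i v i ^+ 2.
Proof. by rewrite raddf_sum /=; apply: eq_bigr => i _; rewrite rmorphXn /= mevalXU. Qed.

Lemma mderiv_var i j : ('X_j : {mpoly R[n]})^`M(i) = (i == j)%:R.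
Proof.
rewrite mderivX mnm1E eq_sym; case: eqP => [->|_]; last by rewrite scale0r.
have -> : (U_(j) - U_(j) = 0)%MM by apply/mnmP => l; rewrite mnmBE subnn mnm0E.
by rewrite mpolyX0 scale1r.
Qed.

End Fischer.

Arguments qform {R n}.

Lemma fischer_gt0 (R : realDomainType) (n : nat) (p : {mpoly R[n]}) :
  p != 0 -> 0 < fischer p p.
Proof.
move=> p_neq0; rewrite /fischer.
have termE m : p@_m * (p^`M[m])@_0 = p@_m ^+ 2 * (\prod_(i < n) (m i)`!)%:R.
  rewrite mcoeff_mderivm addm0 (eq_bigr (fun i => (m i)`!)) => [|i _].
    by rewrite -[in LHS]mulr_natr mulrA expr2.
  by rewrite ffactnn.
have term_ge0 m : 0 <= p@_m * (p^`M[m])@_0 by rewrite termE mulr_ge0 ?sqr_ge0 ?ler0n.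
rewrite lt_neqAle sumr_ge0 // andbT eq_sym psumr_neq0 //.
apply/hasP; exists (mlead p); first exact: mlead_supp.
rewrite termE mulr_gt0 ?ltr0n ?prodn_gt0 // => [|i]; last exact: fact_gt0.
by rewrite exprn_even_gt0 //= mcoeff_eq0 mlead_supp.
Qed.

(** * Zonal harmonics *)

Section Dot.
Variables (R : realType) (n : nat).
Implicit Types x y z : 'rV[R]_n.

Lemma dotvE x y : dotv x y = \sum_i x 0 i * y 0 i.
Proof. by rewrite /dotv mxE; apply: eq_bigr => i _; rewrite mxE. Qed.

Lemma dotvC x y : dotv x y = dotv y x.
Proof. by rewrite !dotvE; apply: eq_bigr => i _; rewrite mulrC. Qed.

Lemma dotvDl x y z : dotv (x + y) z = dotv x z + dotv y z.
Proof. by rewrite /dotv mulmxDl mxE. Qed.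

Lemma dotvZl c x y : dotv (c *: x) y = c * dotv x y.
Proof. by rewrite /dotv -scalemxAl mxE. Qed.

Lemma dotvNl x y : dotv (- x) y = - dotv x y.
Proof. by rewrite -scaleN1r dotvZl mulN1r. Qed.

Lemma dotvBl x y z : dotv (x - y) z = dotv x z - dotv y z.
Proof. by rewrite dotvDl dotvNl. Qed.

Lemma dotv0l x : dotv 0 x = 0.
Proof. by rewrite /dotv mul0mx mxE. Qed.

Lemma dotvDr x y z : dotv z (x + y) = dotv z x + dotv z y.
Proof. by rewrite dotvC dotvDl !(dotvC z). Qed.

Lemma dotvZr c x y : dotv x (c *: y) = c * dotv x y.
Proof. by rewrite dotvC dotvZl dotvC. Qed.

Lemma dotvNr x y : dotv x (- y) = - dotv x y.
Proof. by rewrite dotvC dotvNl dotvC. Qed.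

Lemma dotvBr x y z : dotv z (x - y) = dotv z x - dotv z y.
Proof. by rewrite dotvDr dotvNr. Qed.

Lemma dotv0r x : dotv x 0 = 0.
Proof. by rewrite dotvC dotv0l. Qed.

Definition dotv_bilin := (dotvDl, dotvBl, dotvNl, dotvZl, dotv0l,
  dotvDr, dotvBr, dotvNr, dotvZr, dotv0r).

Lemma dotv_suml (I : Type) (r : seq I) (P : pred I) (F : I -> 'rV[R]_n) x :
  dotv (\sum_(i <- r | P i) F i) x = \sum_(i <- r | P i) dotv (F i) x.
Proof. by rewrite /dotv mulmx_suml summxE. Qed.

Lemma dotv_ge0 x : 0 <= dotv x x.
Proof. by rewrite dotvE sumr_ge0 // => i _; rewrite -expr2 sqr_ge0. Qed.

Lemma dotv_eq0 x : (dotv x x == 0) = (x == 0).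
Proof.
apply/idP/eqP => [|->]; last by rewrite dotv0l.
rewrite dotvE psumr_eq0 => [/allP x_eq0|i _]; last by rewrite -expr2 sqr_ge0.
apply/rowP => i; rewrite mxE; apply/eqP.
by have := x_eq0 i; rewrite mem_index_enum -expr2 sqrf_eq0 => /(_ isT).
Qed.

Lemma dotv_mulmx m (M : 'M[R]_(n, m)) x y :
  M *m M^T = 1%:M -> dotv (x *m M) (y *m M) = dotv x y.
Proof. by move=> MM; rewrite /dotv trmx_mul mulmxA -(mulmxA x) MM mulmx1. Qed.

End Dot.

Section Laplacian.
Variables (R : realType) (n : nat).
Implicit Types (p q : {mpoly R[n]}) (a x : 'rV[R]_n).

Lemma laplacian_is_linear : linear (@laplacian R n).
Proof.
by move=> c p q; rewrite scaler_sumr -big_split; apply: eq_bigr => i _; rewrite !linearP.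
Qed.

HB.instance Definition _ :=
  GRing.isLinear.Build R {mpoly R[n]} {mpoly R[n]} *:%R (@laplacian R n) laplacian_is_linear.

Lemma fischer_mul_qform p q : fischer (qform * p) q = fischer p (laplacian q).
Proof.
rewrite mulr_suml fischer_suml [RHS]raddf_sum /=; apply: eq_bigr => i _.
by rewrite expr2 -mulrA !fischer_mulX.
Qed.

Lemma laplacianM p q :
  laplacian (p * q) =
    laplacian p * q + (\sum_i p^`M(i) * q^`M(i)) *+ 2 + p * laplacian q.
Proof.
rewrite mulr_suml mulr_sumr -sumrMnl -!big_split; apply: eq_bigr => i _ /=.
by rewrite !mderivM mderivD !mderivM; ring.
Qed.

Lemma mderiv_exp i p k : (p ^+ k)^`M(i) = (p ^+ k.-1 * p^`M(i)) *+ k.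
Proof.
elim: k => [|k IHk]; first by rewrite expr0 mulr0n -mpolyC1 mderivC.
rewrite exprS mderivM IHk /=; case: k {IHk} => [|k] /=; first by rewrite !expr0; ring.
by rewrite exprS; ring.
Qed.

Lemma mderiv_linform i a : (linform a)^`M(i) = (a 0 i)%:MP.
Proof.
rewrite raddf_sum /= (bigD1 i) //= big1 ?addr0 => [|j ji].
  by rewrite mderivZ mderiv_var eqxx -mul_mpolyC mulr1.
by rewrite mderivZ mderiv_var eq_sym (negbTE ji) scaler0.
Qed.

Lemma mderiv_qform i : (qform : {mpoly R[n]})^`M(i) = 'X_i *+ 2.
Proof.
rewrite raddf_sum /= (bigD1 i) //= big1 ?addr0 => [|j ji].
  by rewrite mderiv_exp mderiv_var eqxx mulr1.
by rewrite mderiv_exp mderiv_var eq_sym (negbTE ji) mulr0 mul0rn.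
Qed.

Lemma laplacian_linformX a k :
  laplacian (linform a ^+ k) = (dotv a a * (k * k.-1)%:R) *: linform a ^+ k.-2.
Proof.
rewrite dotvE mulr_suml scaler_suml; apply: eq_bigr => i _.
rewrite mderiv_exp mderiv_linform mderivMn mderivM mderivC mderiv_exp mderiv_linform.
rewrite -mul_mpolyC !mpolyCM mpolyC_nat natrM; ring.
Qed.

Lemma laplacian_qformX k :
  laplacian (qform ^+ k : {mpoly R[n]}) = (2 * k * (n + 2 * k.-1))%:R *: qform ^+ k.-1.
Proof.
have termE i : (qform ^+ k : {mpoly R[n]})^`M(i)^`M(i) =
    qform ^+ k.-1 *+ (2 * k) + qform ^+ k.-2 * 'X_i ^+ 2 *+ (4 * k * k.-1).
  rewrite mderiv_exp mderiv_qform mderivMn mderivM mderiv_exp mderiv_qform.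
  by rewrite mderivMn mderiv_var eqxx mulr1n; ring.
rewrite /laplacian (eq_bigr _ (fun i _ => termE i)) big_split /= sumr_const card_ord.
rewrite sumrMnl -mulr_sumr -/qform -mul_mpolyC mpolyC_nat.
case: k {termE} => [|[|k]] /=; rewrite ?exprS; ring.
Qed.

Lemma laplacian_mul_qformX d k p : p \is d.-homog ->
  laplacian (p * qform ^+ k) = laplacian p * qform ^+ k +
    (2 * k * (n + 2 * k.-1 + 2 * d))%:R *: (p * qform ^+ k.-1).
Proof.
move=> /euler_identity eulerp; rewrite laplacianM laplacian_qformX.
have -> : \sum_i p^`M(i) * (qform ^+ k)^`M(i) = (d%:R *: p) * qform ^+ k.-1 *+ (2 * k).
  rewrite -eulerp mulr_suml -sumrMnl; apply: eq_bigr => i _.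
  by rewrite mderiv_exp mderiv_qform; ring.
by rewrite -!mul_mpolyC !mpolyC_nat; ring.
Qed.

End Laplacian.

(* The coefficients of the zonal harmonic of degree [d] in dimension [t], scaled
   so as to be polynomial in [t]. *)
Definition zonal_coef (A : comNzRingType) (t : A) (d i : nat) : A :=
  (-1) ^+ i * \prod_(0 <= l < i) ((d%:R - 2 * l%:R) * (d%:R - 2 * l%:R - 1)) *
  \prod_(i <= l < d./2) (2 * l.+1%:R * (t + 2 * (d%:R - l%:R - 2))).

Lemma rmorph_zonal_coef (A B : comNzRingType) (f : {rmorphism A -> B}) t d i :
  f (zonal_coef t d i) = zonal_coef (f t) d i.
Proof.
rewrite /zonal_coef !rmorphM rmorph_sign !rmorph_prod; congr (_ * _ * _);
by apply: eq_bigr => l _; ring.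
Qed.

Lemma zonal_coefS (A : comNzRingType) (t : A) d i : (i < d./2)%N ->
  zonal_coef t d i * ((d%:R - 2 * i%:R) * (d%:R - 2 * i%:R - 1)) +
  zonal_coef t d i.+1 * (2 * i.+1%:R * (t + 2 * (d%:R - i%:R - 2))) = 0.
Proof.
move=> lt_id; rewrite /zonal_coef (big_ltn lt_id) big_nat_recr //= exprS; ring.
Qed.

Lemma zonal_coef0_gt0 (R : realDomainType) (n d : nat) : (0 < n)%N ->
  0 < zonal_coef (n%:R : R) d 0.
Proof.
move=> n_gt0; rewrite /zonal_coef expr0 big_geq // !mul1r big_mkord prodr_gt0 // => l _.
have -> : d%:R - l%:R - 2 = (d - l - 2)%:R :> R by have := ltn_ord l => ?; rewrite !natrB //; lia.
by rewrite !mulr_gt0 ?ltr0Sn // ltr_wpDr ?mulr_ge0 ?ler0n ?ltr0n.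
Qed.

Section Zonal.
Variables (R : realType) (n : nat).
Implicit Types (f : {mpoly R[n]}) (a x : 'rV[R]_n).

Definition zonal d a : {mpoly R[n]} :=
  \sum_(0 <= i < (d./2).+1)
    (zonal_coef n%:R d i * dotv a a ^+ i) *: (linform a ^+ (d - i.*2) * qform ^+ i).

Lemma zonal_homog d a : zonal d a \is d.-homog.
Proof.
rewrite /zonal big_nat; apply: rpred_sum => i lt_id; apply: rpredZ.
have := dhomogM (dhomogMn (d - i.*2) (linform_homog a)) (dhomogMn i (qform_homog R n)).
by rewrite mul1n mul2n subnK //; lia.
Qed.

Lemma laplacian_zonal d a : laplacian (zonal d a) = 0.
Proof.
rewrite /zonal raddf_sum /=.
have termE i : laplacian ((zonal_coef n%:R d i * dotv a a ^+ i) *: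
      (linform a ^+ (d - i.*2) * qform ^+ i)) =
    (zonal_coef n%:R d i * dotv a a ^+ i.+1 * ((d - i.*2) * (d - i.*2).-1)%:R) *:
      (linform a ^+ (d - i.*2).-2 * qform ^+ i) +
    (zonal_coef n%:R d i * dotv a a ^+ i * (2 * i * (n + 2 * i.-1 + 2 * (d - i.*2)))%:R) *:
      (linform a ^+ (d - i.*2) * qform ^+ i.-1).
  have hlin : linform a ^+ (d - i.*2) \is (1 * (d - i.*2)).-homog.
    exact: dhomogMn (linform_homog a).
  rewrite linearZ /= (laplacian_mul_qformX i hlin) laplacian_linformX mul1n.
  rewrite scalerDr !scalerA -scalerAl scalerA; congr (_ *: _ + _).
  by rewrite exprS; ring.
rewrite (eq_bigr _ (fun i _ => termE i)) big_split /=.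
rewrite big_nat_recr //= [X in _ + X]big_nat_recl //=.
have -> : ((d - d./2.*2) * (d - d./2.*2).-1 = 0)%N.
  by have := odd_double_half d; case: (odd d) => /=; lia.
rewrite !(mulr0, muln0, mul0n, scale0r, addr0, add0r) -big_split.
rewrite big_nat big1 // => i /andP[_ lt_id].
have [e dE] : exists e, d = (e.+2 + i.*2)%N by exists (d - i.*2).-2; lia.
have -> : (d - i.*2 = e.+2)%N by lia.
have -> : (d - i.+1.*2 = e)%N by lia.
rewrite /= -scalerDl [X in X *: _](_ : _ = 0) ?scale0r //.
move: (zonal_coefS (n%:R : R) lt_id); set c := zonal_coef _ _ i; set c' := zonal_coef _ _ i.+1.
move=> coef_rec; rewrite -[RHS](mulr0 (dotv a a ^+ i.+1)) -coef_rec dE -!mul2n; ring.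
Qed.

Lemma harmonic_zonal d a : harmonic d (zonal d a).
Proof. by split; [exact: zonal_homog|exact: laplacian_zonal]. Qed.

Lemma evalv_zonal d a x : evalv (zonal d a) x =
  \sum_(0 <= i < (d./2).+1) zonal_coef n%:R d i *
    (dotv a a ^+ i * dotv x x ^+ i * dotv a x ^+ (d - i.*2)).
Proof.
rewrite /evalv raddf_sum /=; apply: eq_bigr => i _.
rewrite mevalZ mevalM !rmorphXn /= meval_linform meval_qform -dotvE dotvE.
by rewrite [dotv x x]dotvE; under [in RHS]eq_bigr => j _ do rewrite -expr2; ring.
Qed.

Lemma fischer_zonal d a f : harmonic d f ->
  fischer (zonal d a) f = zonal_coef n%:R d 0 * d`!%:R * evalv f a.
Proof.
move=> [homf lapf]; rewrite /zonal big_nat_recl // expr0 !mulr1 double0 subn0.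
rewrite fischerDl fischerZl fischer_linformX // fischer_suml big1 ?addr0 ?mulrA // => i _.
rewrite fischerZl [qform ^+ _]exprS [linform a ^+ _ * _]mulrCA fischer_mul_qform.
by rewrite lapf raddf0 mulr0.
Qed.

(* If the sums vanish then the harmonic polynomial [\sum_(a in Phi) zonal d a] is
   orthogonal to itself, while it represents the functional [\sum_(x in Phi) f x]. *)
Lemma design_cond_zonal d (Phi : seq 'rV[R]_n) : (0 < n)%N ->
  design_cond Phi d <-> {in Phi, forall a, \sum_(x <- Phi) evalv (zonal d a) x = 0}.
Proof.
move=> n_gt0; split=> [design a _|zonal_eq0 f harmf]; first exact/design/harmonic_zonal.
pose H := \sum_(a <- Phi) zonal d a.
have fischerH g : harmonic d g ->
    fischer H g = zonal_coef n%:R d 0 * d`!%:R * \sum_(a <- Phi) evalv g a.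
  by move=> hg; rewrite fischer_suml mulr_sumr; apply: eq_bigr => a _; exact: fischer_zonal.
have homH : H \is d.-homog by apply: rpred_sum => a _; exact: zonal_homog.
have harmH : harmonic d H.
  by split; rewrite // raddf_sum big1 // => a _; exact: laplacian_zonal.
have H_eq0 : H = 0.
  apply/eqP/negPn/negP => /fischer_gt0; rewrite fischerH // /H /evalv.
  under eq_bigr => a _ do rewrite raddf_sum /=.
  by rewrite exchange_big big1_seq ?mulr0 ?ltxx //.
apply/eqP; have /eqP := fischerH f harmf; rewrite H_eq0 fischer0l eq_sym mulf_eq0.
by rewrite gt_eqF // mulr_gt0 ?zonal_coef0_gt0 // ltr0n fact_gt0.
Qed.

End Zonal.

(** * Root systems *)

Section Reflections.
Variables (R : realType) (n : nat).
Implicit Types (a x y : 'rV[R]_n) (Phi : seq 'rV[R]_n).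

Lemma dotv_refl a x y : dotv (refl a x) y = dotv x (refl a y).
Proof. by rewrite /refl !dotv_bilin (dotvC y a); ring. Qed.

Lemma refl_self a : a != 0 -> refl a a = - a.
Proof.
rewrite -dotv_eq0 => aa_neq0; rewrite /refl mulfK //.
by rewrite scaler_nat mulr2n opprD addrA subrr add0r.
Qed.

Lemma reflK a : a != 0 -> involutive (refl a).
Proof.
rewrite -dotv_eq0 => aa_neq0 x; rewrite /refl !dotv_bilin -addrA -opprD -scalerDl.
rewrite [X in X *: a](_ : _ = 0) ?scale0r ?subr0 //; field; exact: aa_neq0.
Qed.

Lemma refl_suml a (I : Type) (r : seq I) (F : I -> 'rV[R]_n) :
  refl a (\sum_(i <- r) F i) = \sum_(i <- r) refl a (F i).
Proof.
by rewrite /refl dotv_suml mulr_sumr mulr_suml scaler_suml -sumrB.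
Qed.

Lemma reflZ a c x : refl a (c *: x) = c *: refl a x.
Proof. by rewrite /refl dotvZl scalerBr scalerA; congr (_ - _ *: _); ring. Qed.

(* [root_frame Phi] commutes with the Weyl group, so every root is an eigenvector;
   its eigenvalue is constant on each irreducible component. *)
Definition root_frame Phi x : 'rV[R]_n := \sum_(z <- Phi) dotv z x *: z.

Definition frame_eigenvalue Phi a : R := (\sum_(z <- Phi) dotv z a ^+ 2) / dotv a a.

Lemma root_frameN Phi x : root_frame Phi (- x) = - root_frame Phi x.
Proof. by rewrite /root_frame -sumrN; apply: eq_bigr => z _; rewrite dotvNr scaleNr. Qed.

Lemma dotv_root_frame Phi x y : dotv (root_frame Phi x) y = dotv x (root_frame Phi y).
Proof.
rewrite [RHS]dotvC /root_frame !dotv_suml.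
by apply: eq_bigr => z _; rewrite !dotvZl mulrC.
Qed.

End Reflections.

Section RootSystem.
Variables (R : realType) (n : nat) (Phi : seq 'rV[R]_n).
Hypothesis rootPhi : root_system Phi.
Implicit Types a b x y z : 'rV[R]_n.

Let uniqPhi : uniq Phi. Proof. by case: rootPhi. Qed.

Lemma root_neq0 a : a \in Phi -> a != 0.
Proof. by case: rootPhi => _ Phi0 _ _; apply: contraTneq => ->. Qed.

Lemma refl_perm a : a \in Phi -> perm_eq (map (refl a) Phi) Phi.
Proof.
move=> aP; have uniq_refl : uniq (map (refl a) Phi).
  by rewrite (map_inj_uniq (can_inj (reflK (root_neq0 aP)))).
have sub : {subset map (refl a) Phi <= Phi}.
  by move=> _ /mapP[x xP ->]; case: rootPhi => _ _ closed _; exact: closed.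
by apply: uniq_perm => //; have [|_] := uniq_min_size uniq_refl sub; rewrite ?size_map.
Qed.

Lemma refl_root_frame a x : a \in Phi ->
  refl a (root_frame Phi x) = root_frame Phi (refl a x).
Proof.
move=> aP; rewrite refl_suml -[RHS](perm_big _ (refl_perm aP)) big_map.
apply: eq_bigr => z _.
by rewrite reflZ dotv_refl (reflK (root_neq0 aP)).
Qed.

Lemma root_frameE a : a \in Phi -> root_frame Phi a = frame_eigenvalue Phi a *: a.
Proof.
move=> aP; have a_neq0 := root_neq0 aP; set v := root_frame Phi a.
have va : dotv v a = \sum_(z <- Phi) dotv z a ^+ 2.
  by rewrite dotv_suml; apply: eq_bigr => z _; rewrite dotvZl expr2.
have : refl a v = - v by rewrite refl_root_frame // refl_self // root_frameN.
rewrite /refl => /eqP; rewrite subr_eq addrC -subr_eq opprK -mulr2n -scaler_nat.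
by rewrite -mulrA -scalerA => /eqP/scalerI ->; rewrite ?pnatr_eq0 // va.
Qed.

Lemma frame_eigenvalue_nonorth a b : a \in Phi -> b \in Phi -> nonorth a b ->
  frame_eigenvalue Phi a = frame_eigenvalue Phi b.
Proof.
move=> aP bP ab; apply: (mulIf ab); have := dotv_root_frame Phi a b.
by rewrite !root_frameE // dotvZl dotvZr.
Qed.

Lemma frame_eigenvalue_gt0 a : a \in Phi -> 0 < frame_eigenvalue Phi a.
Proof.
move=> aP; have aa_gt0 : 0 < dotv a a by rewrite lt_def dotv_eq0 root_neq0 ?dotv_ge0.
rewrite divr_gt0 // (bigD1_seq a) //= ltr_pwDl ?exprn_gt0 //.
by rewrite sumr_ge0 // => z _; rewrite sqr_ge0.
Qed.

Lemma connected_inP x y :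
  reflect (exists2 s : seq 'rV[R]_n, (size s <= size Phi)%N /\ {subset s <= Phi} &
             path (@nonorth R n) x s /\ last x s = y)
          (connected_in Phi x y).
Proof.
apply: (iffP existsP) => [[k /existsP[t /andP[path_t /eqP last_t]]]|].
  exists [seq nth 0 Phi (val i) | i : 'I_(size Phi) <- t] => //.
  split; first by rewrite size_map size_tuple -ltnS.
  by move=> z /mapP[i _ ->]; exact: mem_nth (ltn_ord i).
move=> [s [size_s sP] [path_s last_s]].
exists (Ordinal (size_s : size s < (size Phi).+1)%N); apply/existsP.
have index_s i : (i < size s)%N -> (index (nth 0%R s i) Phi < size Phi)%N.
  by move=> lt_is; rewrite index_mem sP // mem_nth.
exists [tuple Ordinal (index_s i (ltn_ord i)) | i < size s] => /=.
rewrite [map _ _](_ : _ = s); first by rewrite path_s last_s eqxx.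
apply: (@eq_from_nth _ 0) => [|i]; rewrite !size_map -enumT size_enum_ord // => lt_is.
rewrite (nth_map (Ordinal (index_s i lt_is))) ?size_map -?enumT ?size_enum_ord //.
rewrite (nth_map (Ordinal lt_is)) -?enumT ?size_enum_ord //= nth_enum_ord // nth_index //.
by rewrite sP // mem_nth.
Qed.

Lemma connected_in_refl x : connected_in Phi x x.
Proof. by apply/connected_inP; exists [::]. Qed.

Lemma connected_in_rcons x y z : z \in Phi ->
  connected_in Phi x y -> nonorth y z -> connected_in Phi x z.
Proof.
move=> zP /connected_inP[s [_ sP] [path_s last_s]] yz.
have path_sz : path (@nonorth R n) x (rcons s z) by rewrite rcons_path path_s last_s.
case: {path_sz}(shortenP path_sz) (last_rcons x s z) => s' path_s' uniq_s' sub_s' last_s'.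
have s'P : {subset s' <= Phi}.
  by move=> w /sub_s'; rewrite mem_rcons inE => /orP[/eqP-> //|/sP].
apply/connected_inP; exists s' => //; split=> //.
by apply: uniq_leq_size => //; case/andP: uniq_s'.
Qed.

Lemma connected_in_eigenvalue x y : x \in Phi -> connected_in Phi x y ->
  y \in Phi /\ frame_eigenvalue Phi x = frame_eigenvalue Phi y.
Proof.
move=> xP /connected_inP[s [_ sP] [path_s <-]] {y}.
elim: s x xP sP path_s => [|z s IHs] x xP sP //= /andP[xz path_s].
have zP : z \in Phi by apply: sP; rewrite mem_head.
have [||lastP <-] // := IHs z zP; first by move=> w ws; apply: sP; rewrite inE ws orbT.
by split=> //; exact: frame_eigenvalue_nonorth.
Qed.

Lemma mem_component a x : x \in component Phi a = connected_in Phi a x && (x \in Phi).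
Proof. exact: mem_filter. Qed.

Lemma root_frame_component a x : a \in Phi -> x \in component Phi a ->
  root_frame (component Phi a) x = frame_eigenvalue Phi a *: x.
Proof.
move=> aP; rewrite mem_component => /andP[ax xP].
have [_ ->] := connected_in_eigenvalue aP ax.
rewrite -root_frameE // /root_frame big_filter big_mkcond; apply: eq_big_seq => z zP.
case: ifPn => // not_az; suff /eqP-> : dotv z x == 0 by rewrite scale0r.
by apply: contraNT not_az; rewrite dotvC; exact: connected_in_rcons.
Qed.

End RootSystem.

Lemma exists_mem (T : eqType) (s : seq T) : s != [::] -> exists x, x \in s.
Proof. by case: s => // x s _; exists x; rewrite mem_head. Qed.

Lemma mxtrace_idempotent (F : fieldType) (n : nat) (Q : 'M[F]_n) :
  Q *m Q = Q -> \tr Q = (\rank Q)%:R.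
Proof.
move=> QQ; have baseQ := mulmx_base Q.
have {}QQ : row_base Q *m col_base Q = 1%:M.
  apply: (row_free_inj (row_base_free Q)); rewrite mul1mx.
  have free_col : row_free (col_base Q)^T.
    by rewrite /row_free mxrank_tr; exact: col_base_full.
  apply: trmx_inj; apply: (row_free_inj free_col).
  by rewrite -!trmx_mul -[row_base Q *m _ *m _]mulmxA (mulmxA (col_base Q)) !baseQ QQ.
by rewrite -{1}baseQ mxtrace_mulC QQ mxtrace1.
Qed.

Section FrameTrace.
Variables (R : realType) (n : nat).
Implicit Type C : seq 'rV[R]_n.

Lemma mulmx_rows_mx C (u : 'rV[R]_(size C)) :
  u *m rows_mx C = \sum_(i < size C) u 0 i *: C`_i.
Proof. by rewrite mulmx_sum_row; apply: eq_bigr => i _; rewrite rowK. Qed.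

Lemma rows_mx_gram C : rows_mx C *m (rows_mx C)^T = \matrix_(i, j) dotv C`_i C`_j.
Proof.
apply/matrixP => i j; rewrite !mxE dotvE; apply: eq_bigr => k _.
by rewrite !mxE.
Qed.

Lemma root_frame_trace C (l : R) : l != 0 ->
  {in C, forall v, root_frame C v = l *: v} ->
  \sum_(x <- C) dotv x x = l * (span_dim C)%:R.
Proof.
move=> l_neq0 frameC; rewrite /span_dim; set A := rows_mx C.
have AAA : A *m (A^T *m A) = l *: A.
  apply/row_matrixP => i; rewrite mulmxA rows_mx_gram row_mul linearZ /= rowK.
  rewrite mulmx_rows_mx -frameC ?mem_nth // /root_frame (big_nth 0) big_mkord.
  by apply: eq_bigr => j _; rewrite !mxE dotvC.
pose Q := l^-1 *: (A^T *m A).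
have AQ : A *m Q = A by rewrite /Q -scalemxAr AAA scalerA mulVf // scale1r.
have QQ : Q *m Q = Q by rewrite {1}/Q -scalemxAl -mulmxA AQ.
have rankQ : \rank Q = \rank A.
  apply/eqP; rewrite eqn_leq -{2}AQ mxrankM_maxr andbT.
  by rewrite /Q scalemxAl mxrankM_maxr.
rewrite -rankQ -(mxtrace_idempotent QQ) mxtraceZ mulrA mulfV // mul1r mxtrace_mulC.
by rewrite rows_mx_gram (big_nth 0) big_mkord; apply: eq_bigr => i _; rewrite mxE.
Qed.

End FrameTrace.

(** * Simply laced root systems *)

Definition simply_laced (R : realType) (n : nat) (Phi : seq 'rV[R]_n) :=
  root_system Phi /\ norm2 Phi.

Variant root_dot_spec (R : realType) (n : nat) (x y : 'rV[R]_n) : R -> Prop :=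
  | RootDot2 of x = y : root_dot_spec x y 2
  | RootDotN2 of x = - y : root_dot_spec x y (- 2)
  | RootDot1 : root_dot_spec x y 1
  | RootDotN1 : root_dot_spec x y (- 1)
  | RootDot0 : root_dot_spec x y 0.

Section SimplyLaced.
Variables (R : realType) (n : nat) (Phi : seq 'rV[R]_n).
Hypothesis slPhi : simply_laced Phi.
Implicit Types a b c x y z : 'rV[R]_n.

Lemma simply_laced_uniq : uniq Phi.
Proof. by case: slPhi => -[]. Qed.

Lemma root_norm2 x : x \in Phi -> dotv x x = 2.
Proof. by case: slPhi => _; apply. Qed.

Lemma simply_laced_neq0 x : x \in Phi -> x != 0.
Proof. by case: slPhi => rootPhi _; exact: root_neq0. Qed.

Lemma root_dim_gt0 x : x \in Phi -> (0 < n)%N.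
Proof.
move=> /simply_laced_neq0; rewrite lt0n; apply: contraNneq => n0.
by apply/eqP/rowP => -[i lt_i]; exfalso; rewrite n0 in lt_i.
Qed.

Lemma root_sub_dotv x y : x \in Phi -> y \in Phi -> x - dotv x y *: y \in Phi.
Proof.
move=> xP yP; case: slPhi => -[_ _ closed _] _; have := closed x y xP yP.
by rewrite /refl root_norm2 // mulrAC divff ?mul1r ?pnatr_eq0.
Qed.

Lemma root_opp x : x \in Phi -> - x \in Phi.
Proof.
move=> xP; have := root_sub_dotv xP xP.
by rewrite root_norm2 // scaler_nat mulr2n opprD addrA subrr add0r.
Qed.

Lemma root_oppE x : (- x \in Phi) = (x \in Phi).
Proof. by apply/idP/idP => /root_opp //; rewrite opprK. Qed.

Lemma root_opp_perm : perm_eq (map -%R Phi) Phi.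
Proof.
apply: uniq_perm; rewrite ?(map_inj_uniq oppr_inj) ?simply_laced_uniq // => x.
by rewrite -{1}[x]opprK mem_map ?root_oppE //; exact: oppr_inj.
Qed.

Lemma root_sub x y : x \in Phi -> y \in Phi -> dotv x y = 1 -> x - y \in Phi.
Proof. by move=> xP yP xy; have := root_sub_dotv xP yP; rewrite xy scale1r. Qed.

Lemma root_dot_eq2 x y : x \in Phi -> y \in Phi -> dotv x y = 2 -> x = y.
Proof.
move=> xP yP xy; apply/eqP; rewrite -subr_eq0 -dotv_eq0 !dotv_bilin (dotvC y x).
by rewrite !root_norm2 // xy; apply/eqP; ring.
Qed.

Lemma root_dot_le2 x y : x \in Phi -> y \in Phi -> dotv x y <= 2.
Proof.
move=> xP yP; have := dotv_ge0 (x - y).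
by rewrite !dotv_bilin (dotvC y x) !root_norm2 //; lra.
Qed.

Lemma root_dotP x y : x \in Phi -> y \in Phi -> root_dot_spec x y (dotv x y).
Proof.
move=> xP yP; have := root_dot_le2 (root_opp xP) yP; have := root_dot_le2 xP yP.
have [m xyE] : exists m : int, dotv x y = m%:~R.
  apply/intrP; case: slPhi => -[_ _ _ int_dot] _; have := int_dot x y xP yP.
  by rewrite root_norm2 // mulrAC divff ?mul1r ?pnatr_eq0.
rewrite dotvNl xyE -rmorphN -[2]/(2%:~R) !ler_int => le_m2 ge_m2.
have : m = 2 \/ m = -2 \/ m = 1 \/ m = -1 \/ m = 0 by lia.
case=> [|[|[|[|]]]] mE; rewrite mE in xyE *.
- by constructor 1; exact: root_dot_eq2.
- constructor 2; apply: root_dot_eq2; rewrite ?root_opp // dotvNr xyE; ring.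
- by constructor 3.
- by constructor 4.
- by constructor 5.
Qed.

Definition valency a : nat := count (fun x => dotv x a == 1) Phi.

Lemma root_eq_dotv x y : x \in Phi -> y \in Phi -> (dotv x y == 2) = (x == y).
Proof.
move=> xP yP; apply/eqP/eqP => [|->]; [exact: root_dot_eq2|exact: root_norm2].
Qed.

Lemma count_dotvN a (c : R) :
  count (fun x => dotv x a == - c) Phi =
  count (fun x => dotv x a == c) Phi.
Proof.
rewrite -[LHS](permP root_opp_perm) count_map; apply: eq_count => x /=.
by rewrite dotvNl eqr_opp.
Qed.

Lemma count_dotv2 a : a \in Phi -> count (fun x => dotv x a == 2) Phi = 1%N.
Proof.
move=> aP; rewrite (eq_in_count (a2 := pred1 a)) => [|x xP]; last exact: root_eq_dotv.
by rewrite count_uniq_mem ?simply_laced_uniq // aP.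
Qed.

Lemma sum_root_dotv (F : R -> R) a : F 0 = 0 -> a \in Phi ->
  \sum_(x <- Phi) F (dotv x a) = F 2 + F (- 2) + (F 1 + F (- 1)) *+ valency a.
Proof.
move=> F0 aP.
have sum_count (c : R) : \sum_(x <- Phi) F c *+ (dotv x a == c) =
    F c *+ count (fun x => dotv x a == c) Phi.
  by rewrite sumrMnr -sum1_count [in RHS]big_mkcond; congr (_ *+ _).
have countN2 : count (fun x => dotv x a == - 2) Phi = 1%N by rewrite count_dotvN count_dotv2.
transitivity (\sum_(x <- Phi) (F 2 *+ (dotv x a == 2) + F (- 2) *+ (dotv x a == - 2) +
    (F 1 *+ (dotv x a == 1) + F (- 1) *+ (dotv x a == - 1)))).
  apply: eq_big_seq => x xP.
  have [k kS ->] : exists2 k : int, k \in [:: 2; -2; 1; -1; 0] & dotv x a = k%:~R.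
    by case: root_dotP => // *; [exists 2|exists (-2)|exists 1|exists (-1)|exists 0].
  rewrite (eqr_int R k 2) (eqr_int R k (-2)) (eqr_int R k 1) (eqr_int R k (-1)).
  move: kS; rewrite !inE => /or4P[|||/orP[]] /eqP->;
  by rewrite /= ?F0 ?mulr0n ?addr0 ?add0r.
rewrite !big_split /= !sum_count count_dotv2 // countN2 !mulr1n count_dotvN -/(valency a).
by rewrite mulrnDl.
Qed.

End SimplyLaced.

Section CoxeterNumber.
Variables (R : realType) (n : nat) (Phi : seq 'rV[R]_n).
Hypothesis slPhi : simply_laced Phi.
Implicit Types (a c x y : 'rV[R]_n) (C : seq 'rV[R]_n).

Definition orth_nbrs c x := [seq y <- Phi | (dotv y c == 1) && (dotv y x == 0)].

Lemma orth_nbrsP c x y :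
  reflect [/\ y \in Phi, dotv y c = 1 & dotv y x = 0] (y \in orth_nbrs c x).
Proof.
by rewrite mem_filter -andbA; apply: (iffP and3P) => -[] => [/eqP-> /eqP->|? -> ->].
Qed.

Lemma nbrs_sub_perm c : c \in Phi ->
  perm_eq [seq c - y | y <- Phi & dotv y c == 1] [seq y <- Phi | dotv y c == 1].
Proof.
move=> cP; have sub_inj := can_inj (subKr c); have uniqPhi := simply_laced_uniq slPhi.
apply: uniq_perm; rewrite ?(map_inj_uniq sub_inj) ?filter_uniq // => y.
have sub_closed z : (z \in Phi) && (dotv z c == 1) -> (c - z \in Phi) && (dotv (c - z) c == 1).
  move=> /andP[zP /eqP zc]; apply/andP; split; first by apply: root_sub; rewrite // dotvC.
  by rewrite dotvBl (root_norm2 slPhi) // zc; apply/eqP; ring.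
rewrite -{1}[y](subKr c) (mem_map sub_inj) !mem_filter ![_ && (_ \in Phi)]andbC.
by apply/idP/idP => /sub_closed; rewrite ?subKr.
Qed.

Lemma count_nbrs_dot_le0 c x : c \in Phi -> x \in Phi -> dotv x c = 1 ->
  count (fun y => dotv y x <= 0) [seq y <- Phi | dotv y c == 1] = (size (orth_nbrs c x)).+1.
Proof.
move=> cP xP xc; have cx : dotv c x = 1 by rewrite dotvC.
set N := [seq y <- Phi | dotv y c == 1].
have cx_nbr : c - x \in N.
  by rewrite mem_filter root_sub // dotvBl (root_norm2 slPhi cP) xc andbT; apply/eqP; ring.
pose orth y := dotv y x == 0.
have dot_le0E : {in N, (fun y => dotv y x <= 0) =1 predU orth (pred1 (c - x))}.
  move=> y; rewrite mem_filter /= => /andP[/eqP yc yP].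
  have cxP : c - x \in Phi by exact: root_sub.
  rewrite -(root_eq_dotv slPhi) // dotvBr yc /orth.
  have -> : (1 - dotv y x == 2) = (dotv y x == -1) by apply/eqP/eqP; lra.
  have [->|dot_neq0] := eqVneq (dotv y x) 0; first by rewrite lexx.
  have [->|dot_neqN1] := eqVneq (dotv y x) (-1); first by rewrite lerN10.
  apply/negbTE; rewrite -ltNge; move: dot_neq0 dot_neqN1.
  case: (root_dotP slPhi yP xP) => [_|yE|||]; rewrite ?ltr0n ?eqxx //.
  by move: yc; rewrite yE dotvNl xc; lra.
have disjoint_orth : count (predI orth (pred1 (c - x))) N = 0%N.
  apply/eqP; rewrite -leqn0 leqNgt -has_count; apply/hasPn => y _.
  apply/negP => /andP[/eqP yx /eqP yE].
  by move: yx; rewrite yE dotvBl cx (root_norm2 slPhi) //; lra.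
have := count_predUI orth (pred1 (c - x)) N.
rewrite disjoint_orth addn0 -(eq_in_count dot_le0E) => ->.
rewrite count_uniq_mem ?filter_uniq ?(simply_laced_uniq slPhi) // cx_nbr addn1.
by rewrite -size_filter -filter_predI; congr (size _).+1; apply: eq_filter => y /=; rewrite andbC.
Qed.

(* [y |-> c - y] exchanges the neighbours of [c] whose inner product with [x] is 0
   or -1 and those for which it is 1 or 2; the value -1 is attained at [c - x] only. *)
Lemma valency_orth_nbrs c x : c \in Phi -> x \in Phi -> dotv x c = 1 ->
  valency Phi c = (size (orth_nbrs c x)).+1.*2.
Proof.
move=> cP xP xc; have cx : dotv c x = 1 by rewrite dotvC.
rewrite /valency -size_filter -(count_predC (fun y => dotv y x <= 0)).
rewrite [X in (_ + X)%N](_ : _ = count (fun y => dotv y x <= 0) [seq y <- Phi | dotv y c == 1]).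
  by rewrite count_nbrs_dot_le0 // addnn.
rewrite -[RHS](permP (nbrs_sub_perm cP)) count_map; apply: eq_in_count => y.
rewrite mem_filter /= => /andP[_ yP]; rewrite dotvBl cx -ltNge.
by case: (root_dotP slPhi yP xP) => *; apply/idP/idP; lra.
Qed.

Lemma valency_even a : a \in Phi -> ~~ odd (valency Phi a).
Proof.
move=> aP; have [/hasP[x xP /eqP xa]|] := boolP (has (fun x => dotv x a == 1) Phi).
  by rewrite (valency_orth_nbrs aP xP xa) odd_double.
by rewrite has_count -/(valency Phi a) -leqNgt leqn0 => /eqP->.
Qed.

Definition coxeter_regular (h : nat) := {in Phi, forall a, (valency Phi a + 4 = h.*2)%N}.

Lemma sum_sqr_root_dotv a : a \in Phi ->
  \sum_(x <- Phi) dotv x a ^+ 2 = 2 * (valency Phi a + 4)%:R.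
Proof.
move=> aP; rewrite (sum_root_dotv slPhi (F := fun t => t ^+ 2)) ?expr0n // -mulr_natr natrD.
by ring.
Qed.

Lemma eigenvalue_valency a : a \in Phi ->
  frame_eigenvalue Phi a = (valency Phi a + 4)%:R.
Proof.
move=> aP; rewrite /frame_eigenvalue sum_sqr_root_dotv // (root_norm2 slPhi) //.
by rewrite mulrC mulKf ?pnatr_eq0.
Qed.

Lemma sum_norm2 C : norm2 C -> \sum_(x <- C) dotv x x = (2 * size C)%:R :> R.
Proof.
move=> C2; rewrite (eq_big_seq (fun=> 2) C2) big_const_seq count_predT iter_addr_0.
by rewrite -mulrnA.
Qed.

Lemma eigenvalue_coxeter a : a \in Phi ->
  frame_eigenvalue Phi a = 2 * coxeter_number (component Phi a).
Proof.
move=> aP; have [rootPhi _] := slPhi; set C := component Phi a.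
have eigen_neq0 : frame_eigenvalue Phi a != 0 by rewrite gt_eqF // frame_eigenvalue_gt0.
have aC : a \in C by rewrite mem_component connected_in_refl.
have CP x : x \in C -> x \in Phi by rewrite mem_component => /andP[].
have traceC : 2 * (size C)%:R = frame_eigenvalue Phi a * (span_dim C)%:R.
  rewrite -(root_frame_trace eigen_neq0) => [|x xC]; last exact: root_frame_component.
  by rewrite sum_norm2 ?natrM // => x /CP; exact: root_norm2.
rewrite /coxeter_number mulrA traceC mulfK // pnatr_eq0; apply: contraTneq aC => dimC0.
move/eqP: traceC; rewrite dimC0 mulr0 mulf_eq0 !pnatr_eq0 /= size_eq0 => /eqP->.
by rewrite in_nil.
Qed.

Lemma strongly_eutactic_coxeter : strongly_eutactic Phi -> spans Phi -> Phi != [::] ->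
  exists2 h, coxeter_regular h & size Phi = (n * h)%N.
Proof.
move=> eutPhi spPhi /exists_mem[b bP].
have [rootPhi _] := slPhi.
have valency_const a : a \in Phi -> valency Phi a = valency Phi b.
  move=> aP; apply: (@addIn 4); apply/eqP; rewrite -(eqr_nat R) -!eigenvalue_valency //.
  by rewrite !eigenvalue_coxeter // (eutPhi a b).
have regular : coxeter_regular (valency Phi b + 4)./2.
  by move=> a aP; rewrite valency_const // halfK oddD (negbTE (valency_even bP)) subn0.
set h := (_ + 4)./2 in regular; exists h => //.
have eigen_neq0 : frame_eigenvalue Phi b != 0 by rewrite gt_eqF // frame_eigenvalue_gt0.
have trace : (2 * size Phi)%:R = (2 * (n * h))%:R :> R.
  rewrite -sum_norm2; last by case: slPhi.
  rewrite (root_frame_trace eigen_neq0) => [|v vP]; last first.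
    by rewrite root_frameE // !eigenvalue_valency // valency_const.
  by rewrite spPhi eigenvalue_valency // regular // -natrM -mul2n mulnC mulnCA.
by apply/eqP; rewrite -(eqn_pmul2l (isT : 0 < 2)%N) -(eqr_nat R) trace.
Qed.

End CoxeterNumber.

(** * The design equations *)

Section ZonalSum.
Implicit Type A : comNzRingType.

(* The sum over the roots of the zonal harmonic of degree [d] centred at a root, for
   a system of rank [t] and Coxeter number [h]; [4 * h - 8] is twice the valency. *)
Definition zonal_sum A d (t h : A) : A :=
  \sum_(0 <= i < d./2) zonal_coef t d i * (4 ^+ i * (4 * h - 8) + 2 ^+ d.+1) +
  zonal_coef t d d./2 * 2 ^+ d * (t * h).

Lemma rmorph_zonal_sum A (B : comNzRingType) (f : {rmorphism A -> B}) d t h :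
  f (zonal_sum d t h) = zonal_sum d (f t) (f h).
Proof.
rewrite /zonal_sum rmorphD rmorph_sum -rmorph_zonal_coef; congr (_ + _).
  apply: eq_bigr => i _; rewrite -rmorph_zonal_coef; move: (zonal_coef _ _ _) => c.
  by rewrite rmorphM rmorphD rmorphM rmorphB rmorphM !rmorphXn !rmorph_nat.
by move: (zonal_coef _ _ _) => c; rewrite !rmorphM rmorphXn rmorph_nat.
Qed.

End ZonalSum.

Section DesignEquation.
Variables (R : realType) (n : nat) (Phi : seq 'rV[R]_n) (h : nat).
Hypotheses (slPhi : simply_laced Phi) (Phi_neq0 : Phi != [::]).
Hypotheses (regPhi : coxeter_regular Phi h) (sizePhi : size Phi = (n * h)%N).

Lemma sum_expr_root_dotv a e : ~~ odd e -> (0 < e)%N -> a \in Phi ->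
  \sum_(x <- Phi) dotv x a ^+ e = 2 ^+ e.+1 + (4 * h%:R - 8).
Proof.
move=> even_e e_gt0 aP; rewrite (sum_root_dotv slPhi (F := fun t => t ^+ e)) //; last first.
  by rewrite expr0n gtn_eqF.
have sign_even : (-1) ^+ e = 1 :> R by rewrite -signr_odd (negbTE even_e).
rewrite [(- 2) ^+ e]exprNn sign_even mul1r expr1n.
have valencyE : (valency Phi a)%:R = 2 * h%:R - 4 :> R.
  by rewrite -natrM mul2n -(regPhi aP) natrD; ring.
rewrite -[_ *+ valency _ _]mulr_natr valencyE exprS; ring.
Qed.

Lemma sum_zonal d a : ~~ odd d -> a \in Phi ->
  \sum_(x <- Phi) evalv (zonal d a) x = zonal_sum d n%:R h%:R.
Proof.
move=> even_d aP; have dE : d = d./2.*2 by rewrite halfK (negbTE even_d) subn0.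
transitivity (\sum_(0 <= i < (d./2).+1)
    zonal_coef n%:R d i * (4 ^+ i * \sum_(x <- Phi) dotv x a ^+ (d - i.*2))).
  under eq_bigr => x _ do rewrite evalv_zonal.
  rewrite exchange_big; apply: eq_bigr => i _; rewrite -mulr_sumr; congr (_ * _).
  rewrite mulr_sumr; apply: eq_big_seq => x xP.
  by rewrite !(root_norm2 slPhi) // -exprMn -natrM dotvC.
have expr4 i : 4 ^+ i = 2 ^+ i.*2 :> R by rewrite -mul2n exprM; congr (_ ^+ i); ring.
rewrite big_nat_recr //=; congr (_ + _).
  apply: eq_big_nat => i /andP[_ lt_id].
  rewrite sum_expr_root_dotv //; [|lia|lia].
  by rewrite mulrDr addrC {2}expr4 -exprD; congr (_ * (_ + 2 ^+ _)); lia.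
rewrite -dE subnn; under eq_bigr => x _ do rewrite expr0.
by rewrite big_const_seq count_predT iter_addr_0 sizePhi natrM expr4 -dE !mulrA.
Qed.

Lemma design_cond_zonal_sum d : ~~ odd d -> (0 < n)%N ->
  design_cond Phi d <-> zonal_sum d (Z.of_nat n) (Z.of_nat h) = 0.
Proof.
move=> even_d n_gt0; rewrite design_cond_zonal //.
pose f : {rmorphism Z -> R} := intmul 1 \o int_of_Z.
have fE k : f (Z.of_nat k) = k%:R by rewrite /f /= (_ : int_of_Z _ = k%:Z) //; lia.
have f_eq0 z : (f z == 0) = (z == 0) by rewrite /f /= intr_eq0; apply/eqP/eqP; lia.
have sumE a : a \in Phi -> \sum_(x <- Phi) evalv (zonal d a) x =
    f (zonal_sum d (Z.of_nat n) (Z.of_nat h)).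
  by move=> aP; rewrite sum_zonal // rmorph_zonal_sum !fE.
split=> [sum0|sum0 a aP]; last by rewrite (sumE a) // sum0 rmorph0.
have [b bP] := exists_mem Phi_neq0.
by apply/eqP; rewrite -f_eq0 -(sumE b) // sum0.
Qed.

End DesignEquation.

(** * Integral solutions of the design equations *)

Section DesignPolynomial.
Local Open Scope Z_scope.

Definition design_poly (j : nat) (n h : Z) : Z :=
  match j with
  | 1%N => 0
  | 2%N => (n - 10) * h + 6 * (n + 2)
  | 3%N => (n ^ 2 - 48 * n + 272) * h + 30 * (n ^ 2 - 16)
  | 4%N => (n ^ 3 - 84 * n ^ 2 + 1820 * n - 6000) * h +
      42 * (3 * n ^ 3 + 4 * n ^ 2 - 44 * n + 240)
  | 5%N => (n - 2) * ((n ^ 3 - 128 * n ^ 2 + 4624 * n - 51072) * h +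
      30 * (17 * n ^ 3 + 128 * n ^ 2 + 272 * n + 2688))
  | 6%N => (n ^ 5 - 186 * n ^ 4 + 10852 * n ^ 3 - 228504 * n ^ 2 + 1659232 * n - 967680) * h +
      66 * n * (31 * n ^ 4 + 378 * n ^ 3 + 1564 * n ^ 2 + 6552 * n - 22880)
  | _ => 1
  end.

Lemma zonal_sum_design_poly (j : nat) (n h : Z) : (0 < j < 7)%N ->
  exists2 c, 0 < c & zonal_sum j.*2 n h = c * (n + 2 * Z.of_nat j) * design_poly j n h.
Proof.
case: j => [|[|[|[|[|[|[|j]]]]]]] // _;
  [exists 8|exists 32|exists 192|exists 1536|exists 15360|exists 184320] => //.
all: rewrite !doubleS double0 /zonal_sum /zonal_coef unlock [LHS]/= [Z.of_nat _]/= /design_poly.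
all: by ring.
Qed.

Lemma zonal_sum_eq0 j (n h : nat) : (0 < j < 7)%N -> (0 < n)%N ->
  zonal_sum j.*2 (Z.of_nat n) (Z.of_nat h) = 0 <->
  design_poly j (Z.of_nat n) (Z.of_nat h) = 0.
Proof.
move=> j_range n_gt0.
have [c c_gt0 ->] := zonal_sum_design_poly (Z.of_nat n) (Z.of_nat h) j_range.
split=> [/Z.mul_eq_0[|//]|->]; last by rewrite Z.mul_0_r.
nia.
Qed.

(* Below [design_bound j] the equation is solved by inspection; above it both
   coefficients are positive. *)
Definition design_bound j := nth 0%N [:: 0; 0; 10; 42; 50; 76; 96]%N j.

Lemma design_poly_gt0 j (n h : nat) : (1 < j < 7)%N -> (design_bound j <= n)%N -> (0 < h)%N ->
  0 < design_poly j (Z.of_nat n) (Z.of_nat h).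
Proof.
move=> j_range le_n h_gt0; pose m := Z.of_nat n - Z.of_nat (design_bound j).
have -> : Z.of_nat n = m + Z.of_nat (design_bound j) by rewrite /m; lia.
have : 0 <= m by rewrite /m; lia.
have : 0 < Z.of_nat h by lia.
move: m (Z.of_nat h) => m k {le_n}; case: j j_range => [|[|[|[|[|[|[|j]]]]]]] // _;
by rewrite /design_poly /design_bound [Z.of_nat _]/=; nia.
Qed.

End DesignPolynomial.

(* Without this constraint the equations have spurious integral solutions. *)
Definition admissible (n h : nat) :=
  [&& 0 < n, 1 < h & [|| h <= n.+1, h < n.*2 | (4 < n) && (h \in [:: 12; 18; 30])]]%N.

Definition design_parameters (j : nat) : seq (nat * nat) :=
  match j with
  | 2%N => [:: (1, 2); (2, 3); (4, 6); (6, 12); (7, 18); (8, 30)]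
  | 3%N => [:: (1, 2); (2, 2); (8, 30); (16, 30)]
  | 4%N => [:: (1, 2); (2, 3)]
  | 5%N => [:: (1, 2); (2, 2); (2, 3); (4, 6); (8, 30)]
  | 6%N => [:: (1, 2)]
  | _ => [::]
  end%N.

Definition design_search j :=
  all (fun n => all (fun h => admissible n h ==>
        ((design_poly j (Z.of_nat n) (Z.of_nat h) == 0) == ((n, h) \in design_parameters j)))
      (iota 0 (maxn n.*2.+1 31)))
    (iota 0 (design_bound j)).

Lemma design_searchT j : (1 < j < 7)%N -> design_search j.
Proof.
have search : all design_search (iota 2 5) by vm_compute.
by move=> j_range; move/allP: search; apply; rewrite mem_iota.
Qed.

Lemma design_poly_solutions j n h : (1 < j < 7)%N -> admissible n h ->
  design_poly j (Z.of_nat n) (Z.of_nat h) = 0 <-> (n, h) \in design_parameters j.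
Proof.
move=> j_range adm; have h_gt0 : (0 < h)%N by case/and3P: adm => _; lia.
have [le_n|lt_n] := leqP (design_bound j) n.
  split=> [poly0|nh_par]; first by have := design_poly_gt0 j_range le_n h_gt0; rewrite poly0.
  have : all (fun p : nat * nat => p.1 < design_bound j)%N (design_parameters j).
    by case: j j_range {le_n nh_par} => [|[|[|[|[|[|[|j]]]]]]].
  by move/allP/(_ _ nh_par); rewrite ltnNge le_n.
have h_range : (h < maxn n.*2.+1 31)%N.
  by move: adm; rewrite /admissible !inE; lia.
have /allP/(_ n) := design_searchT j_range; rewrite mem_iota lt_n => /(_ isT)/allP/(_ h).
rewrite mem_iota h_range adm => /(_ isT)/eqP <-.
by split=> /eqP.
Qed.

Section DesignParameters.
Variables (R : realType) (n : nat) (Phi : seq 'rV[R]_n) (h : nat).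
Hypotheses (slPhi : simply_laced Phi) (Phi_neq0 : Phi != [::]).
Hypotheses (regPhi : coxeter_regular Phi h) (sizePhi : size Phi = (n * h)%N).
Hypothesis adm_nh : admissible n h.

Lemma design_cond_poly j : (0 < j < 7)%N ->
  design_cond Phi j.*2 <-> design_poly j (Z.of_nat n) (Z.of_nat h) = 0.
Proof.
have n_gt0 : (0 < n)%N by case/and3P: adm_nh.
move=> j_range; rewrite -zonal_sum_eq0 //.
by apply: design_cond_zonal_sum; rewrite ?odd_double.
Qed.

Lemma design_cond_parameters j : (1 < j < 7)%N ->
  design_cond Phi j.*2 <-> (n, h) \in design_parameters j.
Proof.
by move=> j_range; rewrite -(design_poly_solutions j_range adm_nh); apply: design_cond_poly; lia.
Qed.

End DesignParameters.

(** * Orthonormal frames of type D *)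

Section OrthonormalSequences.
Variables (R : realType) (n : nat).
Implicit Types (x y : 'rV[R]_n) (e s : seq 'rV[R]_n).

(* The Gram matrix [(a - b) I + b J] is positive definite. *)
Lemma equiangular_size (a b : R) s : 0 <= b -> b < a -> uniq s ->
  {in s, forall x, dotv x x = a} -> {in s &, forall x y, x != y -> dotv x y = b} ->
  (size s <= n)%N.
Proof.
move=> b_ge0 lt_ba uniq_s norm_s dot_s.
suff /eqP <- : row_free (rows_mx s) by exact: rank_leq_col.
apply: inj_row_free => u u0; apply/rowP => i; rewrite mxE.
pose S := \sum_j u 0 j.
have dot_u j : (a - b) * u 0 j + b * S = 0.
  have /= := congr1 (fun v => dotv v s`_j) u0; rewrite dotv0l mulmx_rows_mx => <-.
  rewrite dotv_suml [RHS](bigD1 j) //=.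
  rewrite dotvZl norm_s ?mem_nth // (eq_bigr (fun k => b * u 0 k)) => [|k kj].
    by rewrite -mulr_sumr /S (bigD1 j) //=; ring.
  by rewrite dotvZl dot_s ?mem_nth ?nth_uniq // mulrC.
have sum_sqr : (a - b) * \sum_j u 0 j ^+ 2 + b * S ^+ 2 = 0.
  transitivity (\sum_j u 0 j * ((a - b) * u 0 j + b * S)); last first.
    by apply: big1 => j _; rewrite dot_u mulr0.
  rewrite mulr_sumr expr2 mulrA [b * S * S]mulr_sumr -big_split; apply: eq_bigr => j _ /=.
  by ring.
have /eqP : \sum_j u 0 j ^+ 2 = 0.
  apply: (mulfI (lt0r_neq0 (_ : 0 < a - b))); rewrite ?subr_gt0 // mulr0.
  have := mulr_ge0 b_ge0 (sqr_ge0 S); have : 0 <= (a - b) * \sum_j u 0 j ^+ 2.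
    by rewrite mulr_ge0 ?subr_ge0 ?(ltW lt_ba) ?sumr_ge0 // => j _; exact: sqr_ge0.
  by lra.
rewrite psumr_eq0 => [/allP/(_ i)|j _]; last exact: sqr_ge0.
by rewrite mem_index_enum sqrf_eq0 => /(_ isT)/eqP.
Qed.

Definition orthonormal_seq e := uniq e /\ {in e &, forall x y, dotv x y = (x == y)%:R}.

Lemma orthonormal_size e : orthonormal_seq e -> (size e <= n)%N.
Proof.
move=> [uniq_e dot_e]; apply: (@equiangular_size 1 0) => // [x xe|x y xe ye /negbTE xy].
  by rewrite dot_e // eqxx.
by rewrite dot_e // xy.
Qed.

Lemma orthonormal_nth e i j : orthonormal_seq e -> (i < size e)%N -> (j < size e)%N ->
  dotv e`_i e`_j = (i == j)%:R.
Proof. by move=> [uniq_e dot_e] lt_i lt_j; rewrite dot_e ?mem_nth // nth_uniq. Qed.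

Lemma orthonormal_mx e : orthonormal_seq e -> size e = n ->
  let E : 'M[R]_n := \matrix_(i < n) e`_i in E *m E^T = 1%:M.
Proof.
move=> [uniq_e dot_e] size_e; apply/matrixP => i j; rewrite !mxE.
transitivity (dotv e`_i e`_j); first by rewrite dotvE; apply: eq_bigr => k _; rewrite !mxE.
by rewrite dot_e ?mem_nth ?size_e // nth_uniq ?size_e.
Qed.

Lemma orthonormal_full e x : orthonormal_seq e -> size e = n ->
  {in e, forall y, dotv x y = 0} -> x = 0.
Proof.
move=> on_e size_e x_orth; have := orthonormal_mx on_e size_e.
set E : 'M_n := \matrix_i _ => /mulmx1C EE; rewrite -[x]mulmx1 -EE mulmxA.
rewrite [x *m E^T](_ : _ = 0) ?mul0mx //; apply/rowP => i; rewrite !mxE.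
rewrite -[RHS](x_orth e`_i) ?mem_nth ?size_e // dotvE.
by apply: eq_bigr => k _; rewrite !mxE.
Qed.

End OrthonormalSequences.

Lemma exists_neq_mem (T : eqType) (x : T) (s : seq T) :
  uniq s -> (1 < size s)%N -> exists2 y, y \in s & y != x.
Proof.
move=> uniq_s size_s; suff /hasP[y ys yx] : has (predC1 x) s by exists y.
rewrite has_count -(ltn_add2l (count_mem x s)) addn0 count_predC count_uniq_mem //.
by case: (x \in s) => //; exact: ltnW.
Qed.

Section Frames.
Variables (R : realType) (n : nat) (Phi : seq 'rV[R]_n).
Hypothesis slPhi : simply_laced Phi.
Implicit Types (x y z r v : 'rV[R]_n) (e : seq 'rV[R]_n).

Definition Dframe e :=
  orthonormal_seq e /\ {in e &, forall x y, x != y -> x + y \in Phi /\ x - y \in Phi}.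

Definition orth_all e r := all (fun x => dotv r x == 0) e.

Lemma orth_allP e r : reflect {in e, forall x, dotv r x = 0} (orth_all e r).
Proof. by apply: (iffP allP) => orth_r x /orth_r/eqP. Qed.

Lemma Dframe_sub e e' : Dframe e -> uniq e' -> {subset e' <= e} -> Dframe e'.
Proof.
move=> [[_ dot_e] rootD] uniq_e' sub; split; first split=> //.
  by move=> x y /sub xe /sub; exact: dot_e.
by move=> x y /sub xe /sub; exact: rootD.
Qed.

Lemma Dframe_cons e v : Dframe e -> dotv v v = 1 -> orth_all e v ->
  {in e, forall x, v + x \in Phi /\ v - x \in Phi} -> Dframe (v :: e).
Proof.
move=> [[uniq_e dot_e] rootD] vv /orth_allP v_orth rootv.
have v_notin : v \notin e by apply/negP => /v_orth/eqP; rewrite vv oner_eq0.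
have v_neq x : x \in e -> (v == x) = false by move=> xe; apply: contraNF v_notin => /eqP->.
split; first split; first by rewrite /= v_notin.
  move=> x y; rewrite !inE => /orP[/eqP->|xe] /orP[/eqP->|ye]; rewrite ?vv ?eqxx //.
  - by rewrite v_orth // v_neq.
  - by rewrite dotvC v_orth // eq_sym v_neq.
  - exact: dot_e.
move=> x y; rewrite !inE => /orP[/eqP->|xe] /orP[/eqP->|ye]; rewrite ?eqxx // => xy.
- exact: rootv.
- by have [? ?] := rootv x xe; rewrite addrC -(root_oppE slPhi (x - v)) opprB.
- exact: rootD.
Qed.

Lemma Dframe_opp e (s : pred 'rV[R]_n) : Dframe e ->
  Dframe [seq if s x then - x else x | x <- e].
Proof.
move=> [[uniq_e dot_e] rootD]; pose f x := if s x then - x else x.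
have dot_f x y : x \in e -> y \in e -> x != y -> dotv (f x) (f y) = 0.
  move=> xe ye /negbTE xy; rewrite /f.
  by case: ifP; case: ifP => _ _; rewrite ?dotv_bilin dot_e // xy ?oppr0.
have norm_f x : x \in e -> dotv (f x) (f x) = 1.
  by move=> xe; rewrite /f; case: ifP => _; rewrite ?dotv_bilin ?opprK dot_e // eqxx.
have inj_f : {in e &, injective f}.
  move=> x y xe ye fxy; apply/eqP/negPn/negP => xy; have := dot_f x y xe ye xy.
  by rewrite -fxy norm_f // => /eqP; rewrite oner_eq0.
split; first split; first by rewrite map_inj_in_uniq.
  move=> _ _ /mapP[x xe ->] /mapP[y ye ->]; rewrite (inj_in_eq inj_f) //.
  by have [<-|xy] := eqVneq x y; [exact: norm_f|exact: dot_f].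
move=> _ _ /mapP[x xe ->] /mapP[y ye ->]; rewrite (inj_in_eq inj_f) // => xy.
have [sumP subP] := rootD x y xe ye xy; have opp := root_oppE slPhi.
case: ifP; case: ifP => _ _; rewrite ?opprK; split=> //.
- by rewrite -opprD opp.
- by rewrite addrC -opprB opp.
- by rewrite addrC -opprB opp.
- by rewrite -opprD opp.
Qed.

(* [r - x] is a new unit vector orthogonal to the frame. *)
Lemma Dframe_extend e x r : Dframe e -> (1 < size e)%N -> x \in e -> r \in Phi ->
  dotv r x = 1 -> {in e, forall y, y != x -> dotv r y = 0} -> Dframe (r - x :: e).
Proof.
move=> De size_e xe rP rx r_orth; have [[uniq_e dot_e] rootD] := De.
have xx : dotv x x = 1 by rewrite dot_e // eqxx.
have v_orth : {in e, forall y, dotv (r - x) y = 0}.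
  move=> y ye; rewrite dotvBl; have [->|yx] := eqVneq y x; first by rewrite rx xx subrr.
  by rewrite r_orth // dot_e // eq_sym (negbTE yx) subrr.
have rootv y : y \in e -> y != x -> (r - x) + y \in Phi /\ (r - x) - y \in Phi.
  move=> ye yx; have ry := r_orth y ye yx.
  have [xyD xyB] : x + y \in Phi /\ x - y \in Phi by apply: rootD; rewrite // eq_sym.
  split; last first.
    by rewrite -addrA -opprD; apply: root_sub; rewrite // dotvDr rx ry addr0.
  by rewrite addrAC -addrA -opprB; apply: root_sub; rewrite // dotvBr rx ry subr0.
have vv : dotv (r - x) (r - x) = 1.
  by rewrite dotvBr (v_orth x) // subr0 dotvBl (dotvC x) rx (root_norm2 slPhi) //; ring.
apply: Dframe_cons => // [|y ye]; first exact/orth_allP.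
have [->|/rootv] := eqVneq y x; last exact.
rewrite subrK; split=> //; have [z ze zx] := exists_neq_mem x uniq_e size_e.
have [vzD _] := rootv z ze zx; have [zxD _] := rootD z x ze xe zx.
rewrite [r - x - x](_ : _ = (r - x + z) - (z + x)); last by rewrite opprD addrA addrK.
apply: root_sub => //; rewrite dotvDl !dotvDr !v_orth //.
by rewrite !dot_e // eqxx (negbTE zx) mulr1n mulr0n !add0r addr0.
Qed.

Definition D_extending e r :=
  has (fun x => (`|dotv r x| == 1) && all (fun y => (y == x) || (dotv r y == 0)) e) e.

Lemma D_extendingP e r : Dframe e -> (1 < size e)%N -> r \in Phi -> D_extending e r ->
  exists v, Dframe (v :: e).
Proof.
move=> De size_e rP /hasP[x xe /andP[rx /allP r_orth]].
have {}r_orth y : y \in e -> y != x -> dotv r y = 0.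
  by move=> ye yx; have := r_orth y ye; rewrite (negbTE yx) => /eqP.
move: rx; rewrite eqr_norml => /andP[/orP[]/eqP rx _].
  by exists (r - x); exact: Dframe_extend.
exists (- r - x); apply: Dframe_extend; rewrite ?(root_oppE slPhi) // ?dotvNl ?rx ?opprK //.
by move=> y ye yx; rewrite dotvNl r_orth // oppr0.
Qed.

Lemma Dframe_maximal e : Dframe e -> (1 < size e)%N ->
  exists e', [/\ Dframe e', (size e <= size e')%N & ~~ has (D_extending e') Phi].
Proof.
have [k] := ubnP (n - size e)%N; elim: k e => // k IHk e lt_k De size_e.
have [/hasP[r rP /(D_extendingP De size_e rP)[v Dv]]|max_e] := boolP (has (D_extending e) Phi);
  last by exists e.
have /= size_v := orthonormal_size Dv.1.
have lt_k' : (n - size (v :: e) < k)%N by rewrite /=; lia.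
have [|e' [De' size_e' max_e']] := IHk _ lt_k' Dv; first exact: ltnW.
by exists e'; split=> //; exact: ltnW.
Qed.

Lemma Dframe_pair y z : y \in Phi -> z \in Phi -> dotv y z = 0 ->
  Dframe [:: 2^-1 *: (y + z); 2^-1 *: (y - z)].
Proof.
move=> yP zP yz; have zy : dotv z y = 0 by rewrite dotvC.
have half_sum u v : 2^-1 *: (u + v) + 2^-1 *: (u - v) = u :> 'rV[R]_n.
  by apply/rowP => i; rewrite !mxE; field.
have half_diff u v : 2^-1 *: (u + v) - 2^-1 *: (u - v) = v :> 'rV[R]_n.
  by apply/rowP => i; rewrite !mxE; field.
have dots := (root_norm2 slPhi yP, root_norm2 slPhi zP, yz, zy).
apply: Dframe_cons.
- split; last by move=> x w; rewrite !inE => /eqP-> /eqP->; rewrite eqxx.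
  split=> // x w; rewrite !inE => /eqP-> /eqP->; rewrite eqxx.
  by rewrite !dotv_bilin !dots mulr1n; field.
- by rewrite !dotv_bilin !dots; field.
- by rewrite /orth_all /= andbT !dotv_bilin !dots; apply/eqP; field.
- by move=> x; rewrite inE => /eqP->; rewrite half_sum half_diff.
Qed.

(* A root with three mutually orthogonal neighbours: the Dynkin diagram D4. *)
Lemma Dframe_star c x y z : [/\ c \in Phi, x \in Phi, y \in Phi & z \in Phi] ->
  [/\ dotv x c = 1, dotv y c = 1 & dotv z c = 1] ->
  [/\ dotv y x = 0, dotv z x = 0 & dotv y z = 0] ->
  let f := 2^-1 *: (y + z) in Dframe [:: x - (c - f); c - f; f; 2^-1 *: (y - z)].
Proof.
move=> [cP xP yP zP] [xc yc zc] [yx zx yz] f.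
have := Dframe_pair yP zP yz; rewrite -/f; set g := 2^-1 *: (y - z) => D2.
have [cf cg] : dotv c f = 1 /\ dotv c g = 0.
  by rewrite /f /g ![dotv c _]dotvC !dotv_bilin yc zc; split; field.
have [xf xg] : dotv x f = 0 /\ dotv x g = 0.
  by rewrite /f /g ![dotv x _]dotvC !dotv_bilin yx zx; split; field.
have D3 : Dframe [:: c - f; f; g].
  apply: Dframe_extend; rewrite ?mem_head // => w.
  by rewrite !inE => /orP[]/eqP->; rewrite ?eqxx.
apply: Dframe_extend; rewrite ?mem_head // ?dotvBr ?xc ?xf ?subr0 // => w.
by rewrite !inE => /or3P[]/eqP->; rewrite ?eqxx.
Qed.

Lemma Dframe_nth e i j : Dframe e -> (i < size e)%N -> (j < size e)%N -> i != j ->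
  e`_i + e`_j \in Phi /\ e`_i - e`_j \in Phi.
Proof.
by move=> [[uniq_e _] rootD] lt_i lt_j ij; apply: rootD; rewrite ?mem_nth ?nth_uniq.
Qed.

(* The half-spin root is a vector root for another orthonormal frame of the same D4. *)
Lemma D4_triality e r : Dframe e -> size e = 4%N -> r \in Phi ->
  {in e, forall x, dotv r x = 2^-1} -> exists2 e5, Dframe e5 & size e5 = 5%N.
Proof.
move=> De size_e rP r_half.
have dot_nth i j : (i < 4)%N -> (j < 4)%N -> dotv e`_i e`_j = (i == j)%:R.
  by rewrite -size_e; exact: orthonormal_nth De.1.
have half_nth i : (i < 4)%N -> dotv r e`_i = 2^-1.
  by rewrite -size_e => lt_i; rewrite r_half ?mem_nth.
have root_nth i j : (i < 4)%N -> (j < 4)%N -> i != j ->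
    e`_i + e`_j \in Phi /\ e`_i - e`_j \in Phi.
  by rewrite -size_e; exact: Dframe_nth.
have [_ yP] := root_nth 0%N 1%N isT isT isT; have [xP zP] := root_nth 2%N 3%N isT isT isT.
have [_ cP] := root_nth 2%N 1%N isT isT isT.
have nbrs : [/\ dotv (e`_2 + e`_3) (e`_2 - e`_1) = 1, dotv (e`_0 - e`_1) (e`_2 - e`_1) = 1 &
    dotv (e`_2 - e`_3) (e`_2 - e`_1) = 1] by rewrite !dotv_bilin !dot_nth //=; split; ring.
have nbrs_orth : [/\ dotv (e`_0 - e`_1) (e`_2 + e`_3) = 0, dotv (e`_2 - e`_3) (e`_2 + e`_3) = 0 &
    dotv (e`_0 - e`_1) (e`_2 - e`_3) = 0] by rewrite !dotv_bilin !dot_nth //=; split; ring.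
have /= D4 := Dframe_star (And4 cP xP yP zP) nbrs nbrs_orth.
eexists; [apply: (Dframe_extend D4 isT (mem_head _ _) rP) => [|w]|by []].
  by rewrite !dotv_bilin !half_nth //; field.
rewrite !inE => /or4P[]/eqP->; rewrite ?eqxx // => _;
by rewrite !dotv_bilin !half_nth //; field.
Qed.

End Frames.

Section FrameRoots.
Variables (R : realType) (n : nat) (Phi : seq 'rV[R]_n).
Hypothesis slPhi : simply_laced Phi.
Implicit Types (x y z r : 'rV[R]_n) (e : seq 'rV[R]_n).

Definition D_root e r := has (fun x => has (fun y => (x != y) &&
  [|| r == x + y, r == x - y | r == - x - y]) e) e.

Definition half_spin e r := all (fun x => `|dotv r x| == 2^-1) e.

Lemma unit_or_half (s t : R) : s + t \in [:: 0; 1; -1] -> s - t \in [:: 0; 1; -1] ->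
  [\/ s = 0, `|s| = 1 /\ t = 0 | `|s| = 2^-1 /\ `|t| = 2^-1].
Proof.
have norm_eq (u c : R) : u = c \/ u = - c -> 0 <= c -> `|u| = c.
  by move=> [] -> c_ge0; rewrite ?normrN ger0_norm.
rewrite !inE => /or3P[]/eqP st_sum /or3P[]/eqP st_diff.
all: solve [constructor 1; lra | constructor 2; split; [apply: norm_eq|]; lra
           | constructor 3; split; apply: norm_eq; lra].
Qed.

Lemma root_dot_unit r x : r \in Phi -> x \in Phi -> r != x -> r != - x ->
  dotv r x \in [:: 0; 1; -1].
Proof.
by move=> rP xP; case: (root_dotP slPhi rP xP) => [->|->|||]; rewrite ?eqxx // !inE ?eqxx ?orbT.
Qed.

Lemma Dframe_coords e r x y : Dframe Phi e -> r \in Phi -> ~~ D_root e r ->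
  x \in e -> y \in e -> x != y ->
  dotv r x + dotv r y \in [:: 0; 1; -1] /\ dotv r x - dotv r y \in [:: 0; 1; -1].
Proof.
move=> [_ rootD] rP notD xe ye xy; have [sumP subP] := rootD x y xe ye xy.
have not_pm z w : z \in e -> w \in e -> z != w -> [/\ r != z + w, r != z - w & r != - z - w].
  move=> ze we zw; split; apply: contraNneq notD => rE; apply/hasP; exists z => //;
  by apply/hasP; exists w; rewrite // zw rE eqxx ?orbT.
have [r_sum r_sub r_opp] := not_pm x y xe ye xy.
have [_ r_sub_swap _] := not_pm y x ye xe ltac:(by rewrite eq_sym).
by split; [rewrite -dotvDr|rewrite -dotvBr]; apply: root_dot_unit; rewrite // ?opprB ?opprD.
Qed.

Lemma Dframe_root_cases e r : Dframe Phi e -> (1 < size e)%N -> r \in Phi ->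
  [|| D_root e r, orth_all e r, D_extending e r | half_spin e r].
Proof.
move=> De size_e rP; have [//|notD /=] := boolP (D_root e r).
have [//|/allPn[x xe rx_neq0] /=] := boolP (orth_all e r); have [[uniq_e _] _] := De.
have coords y : y \in e -> y != x ->
    `|dotv r x| = 1 /\ dotv r y = 0 \/ `|dotv r x| = 2^-1 /\ `|dotv r y| = 2^-1.
  move=> ye yx; have [sum_xy diff_xy] := Dframe_coords De rP notD xe ye ltac:(by rewrite eq_sym).
  by have [/eqP|?|?] := unit_or_half sum_xy diff_xy; [rewrite (negbTE rx_neq0)|left|right].
have [z ze zx] := exists_neq_mem x uniq_e size_e.
have [[rx _]|[rx _]] := coords z ze zx; apply/orP; [left|right].
  apply/hasP; exists x; rewrite // rx eqxx; apply/allP => y ye /=.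
  by have [//|/(coords y ye)[[_ ->]|[]]] := eqVneq y x; rewrite ?eqxx // rx; lra.
apply/allP => y ye; have [->|/(coords y ye)[[]|[_ ->]]] := eqVneq y x; rewrite ?rx ?eqxx //.
by lra.
Qed.

Lemma half_spin_normalize e r : Dframe Phi e -> half_spin e r ->
  exists e', [/\ Dframe Phi e', size e' = size e & {in e', forall x, dotv r x = 2^-1}].
Proof.
move=> De /allP r_half; pose s x := dotv r x == - 2^-1.
exists [seq if s x then - x else x | x <- e].
split; rewrite ?size_map //; first exact: Dframe_opp.
move=> _ /mapP[x xe ->]; rewrite /s; case: ifPn => [/eqP rx|]; first by rewrite dotvNr rx opprK.
by move: (r_half x xe); rewrite eqr_norml => /andP[/orP[]/eqP-> //]; rewrite eqxx.
Qed.

(* The half-spin root joined to a system of type D5 makes it a system of type E6. *)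
Definition has_spinor := exists2 r, r \in Phi &
  exists e, [/\ Dframe Phi e, size e = 5%N & {in e, forall x, dotv r x = 2^-1}].

Definition D_closed e := all (fun r => D_root e r || orth_all e r) Phi.

Lemma Dframe5_dichotomy e : Dframe Phi e -> (4 < size e)%N ->
  (exists e', [/\ Dframe Phi e', (4 < size e')%N & D_closed e']) \/ has_spinor.
Proof.
move=> De size_e; have [|e' [De' size_e' /hasPn maximal_e']] := Dframe_maximal slPhi De.
  exact: leq_trans size_e.
have size5 := leq_trans size_e size_e'.
have [/hasP[r rP r_half]|/hasPn no_half] := boolP (has (half_spin e') Phi).
  have [f [Df size_f r_halff]] := half_spin_normalize De' r_half; right; exists r => //.
  exists (take 5 f); split; last by move=> x /mem_take; exact: r_halff.
    by apply: (Dframe_sub Df); [rewrite take_uniq //; case: Df => -[]|exact: mem_take].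
  by rewrite size_takel ?size_f.
left; exists e'; split=> //; apply/allP => r rP.
have := Dframe_root_cases De' (ltnW (ltnW (ltnW size5))) rP.
by rewrite (negbTE (maximal_e' r rP)) (negbTE (no_half r rP)) !orbF.
Qed.

Lemma Dframe4_dichotomy e : Dframe Phi e -> size e = 4%N ->
  (exists e', [/\ Dframe Phi e', (3 < size e')%N & D_closed e']) \/ has_spinor.
Proof.
move=> De size_e; have size_gt1 : (1 < size e)%N by rewrite size_e.
have from_D5 e5 : Dframe Phi e5 -> size e5 = 5%N ->
    (exists e', [/\ Dframe Phi e', (3 < size e')%N & D_closed e']) \/ has_spinor.
  move=> D5 size5; have [||] := Dframe5_dichotomy D5; rewrite ?size5 //; last by right.
  by move=> [e' [De' size_e' cl_e']]; left; exists e'; split=> //; exact: ltnW.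
have [/hasP[r rP /(D_extendingP slPhi De size_gt1 rP)[v Dv]]|/hasPn maximal_e] :=
    boolP (has (D_extending e) Phi).
  by apply: (from_D5 _ Dv); rewrite /= size_e.
have [/hasP[r rP r_half]|/hasPn no_half] := boolP (has (half_spin e) Phi).
  have [e' [De' size_e' r_half']] := half_spin_normalize De r_half.
  have [|e5 D5 size5] := D4_triality slPhi De' _ rP r_half'; first by rewrite size_e'.
  exact: (from_D5 e5).
left; exists e; split; rewrite ?size_e //; apply/allP => r rP.
have := Dframe_root_cases De size_gt1 rP.
by rewrite (negbTE (maximal_e r rP)) (negbTE (no_half r rP)) !orbF.
Qed.

End FrameRoots.

Section ClosedFrames.
Variables (R : realType) (n : nat) (Phi : seq 'rV[R]_n).
Hypothesis slPhi : simply_laced Phi.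
Implicit Types (c x y z r : 'rV[R]_n) (e : seq 'rV[R]_n).

Lemma D_rootP e r :
  reflect (exists x y, [/\ x \in e, y \in e, x != y &
             [\/ r = x + y, r = x - y | r = - x - y]])
          (D_root e r).
Proof.
apply: (iffP hasP) => [[x xe /hasP[y ye /andP[xy rE]]]|[x [y [xe ye xy rE]]]].
  exists x, y; split=> //.
  by case/or3P: rE => /eqP rE; [constructor 1|constructor 2|constructor 3].
exists x => //; apply/hasP; exists y; rewrite // xy.
by case: rE => ->; rewrite eqxx ?orbT.
Qed.

Lemma D_root_dot_unit e r x : orthonormal_seq e -> D_root e r -> x \in e ->
  dotv r x \in [:: 0; 1; -1].
Proof.
move=> [_ dot_e] /D_rootP[y [z [ye ze yz rE]]] xe.
have : ~~ ((y == x) && (z == x)) by apply: contraNN yz => /andP[/eqP-> /eqP->].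
case: rE => ->; rewrite !dotv_bilin !dot_e //; case: (y == x); case: (z == x) => //= _;
by rewrite ?mulr0n ?mulr1n ?oppr0 ?addr0 ?add0r !inE eqxx ?orbT.
Qed.

Lemma D_root_dot1 e r x : orthonormal_seq e -> D_root e r -> x \in e -> dotv r x = 1 ->
  exists z, [/\ z \in e, z != x & r = x + z \/ r = x - z].
Proof.
move=> [_ dot_e] /D_rootP[y [z [ye ze yz rE]]] xe.
have zy : z != y by rewrite eq_sym.
case: rE => rE; rewrite {1}rE !dotv_bilin !dot_e //.
- have [<- _|yx] := eqVneq y x; first by exists z; split=> //; left.
  have [<- _|zx] := eqVneq z x; first by exists y; split=> //; left; rewrite addrC.
  by rewrite !mulr0n addr0 => /eqP; rewrite eq_sym oner_eq0.
- have [<- _|yx] := eqVneq y x; first by exists z; split=> //; right.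
  by have := ler0n R (z == x); rewrite mulr0n; lra.
- by have := ler0n R (z == x); have := ler0n R (y == x); lra.
Qed.

Lemma count_closed_dot e x y : Dframe Phi e -> D_closed Phi e -> x \in e -> y \in e -> x != y ->
  count (fun r => (dotv r x == 1) && (dotv r y == 0)) Phi = (size e - 2).*2.
Proof.
move=> [on_e rootD] /allP closed xe ye xy; have [uniq_e dot_e] := on_e.
pose f := rem y (rem x e).
have fP z : z \in f -> [/\ z \in e, z != x & z != y].
  by rewrite mem_rem_uniq ?rem_uniq // inE mem_rem_uniq // inE => /and3P[].
have size_f : size f = (size e - 2)%N.
  have y_rem : y \in rem x e by rewrite mem_rem_uniq // !inE eq_sym xy.
  by rewrite /f !size_rem // subn2.
rewrite -size_f -size_filter -addnn.
rewrite -{1}(size_map (fun z => x + z) f) -(size_map (fun z => x - z) f) -size_cat.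
 apply: perm_size; apply: uniq_perm.
- by rewrite filter_uniq ?(simply_laced_uniq slPhi).
- have uniq_f : uniq f by rewrite !rem_uniq.
  rewrite cat_uniq (map_inj_uniq (addrI x)) (map_inj_uniq (inj_comp (addrI x) oppr_inj)).
  rewrite uniq_f andbT /=.
  apply/hasPn => _ /mapP[z /fP[ze zx _] ->]; apply/mapP => -[w /fP[we wx _] /addrI zw].
  have := dot_e w w we we; rewrite -{2}zw dotvNr dot_e // eqxx mulr1n.
  by have := ler0n R (w == z); lra.
move=> r; rewrite mem_filter mem_cat; apply/idP/idP.
  case/andP=> /andP[/eqP rx /eqP ry] rP.
  case/orP: (closed r rP) => [Dr|/orth_allP/(_ x xe)]; last first.
    by rewrite rx => /eqP; rewrite oner_eq0.
  have [z [ze zx rE]] := D_root_dot1 on_e Dr xe rx.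
  have zf : z \in f.
    rewrite mem_rem_uniq ?rem_uniq // inE mem_rem_uniq // inE ze zx !andbT.
    apply/eqP => zy; move: ry.
    by case: rE => ->; rewrite !dotv_bilin zy !dot_e // eqxx (negbTE xy) mulr0n mulr1n; lra.
  by case: rE => ->; apply/orP; [left|right]; apply: map_f.
have dots z : z \in f -> [/\ dotv x x = 1, dotv x y = 0, dotv z x = 0, dotv z y = 0 & x != z].
  by move=> /fP[ze zx zy]; rewrite !dot_e // eqxx (negbTE xy) (negbTE zx) (negbTE zy) eq_sym.
by case/orP=> /mapP[z zf ->]; have [xx xy0 zx0 zy0 xz] := dots z zf; have [ze _ _] := fP z zf;
  have [sumP subP] := rootD x z xe ze xz; rewrite !dotv_bilin xx xy0 zx0 zy0 ?subr0 ?addr0 !eqxx.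
Qed.

Lemma unit_sum_eq1 (s t : R) : s \in [:: 0; 1; -1] -> t \in [:: 0; 1; -1] ->
  (s + t == 1) = (s == 1) && (t == 0) || (t == 1) && (s == 0).
Proof.
rewrite !inE => s_unit t_unit; apply/eqP/orP => [st|].
  have [s0|s_neq0] := eqVneq s 0; first by right; rewrite andbT; apply/eqP; lra.
  have [t0|t_neq0] := eqVneq t 0; first by left; rewrite andbT; apply/eqP; lra.
  move: s_unit t_unit st; rewrite (negbTE s_neq0) (negbTE t_neq0) /=.
  by case/orP=> /eqP-> /orP[]/eqP->; lra.
by case=> /andP[/eqP-> /eqP->]; lra.
Qed.

Lemma closed_frame_valency e x y : Dframe Phi e -> D_closed Phi e ->
  x \in e -> y \in e -> x != y -> valency Phi (x + y) = (4 * (size e - 2))%N.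
Proof.
move=> De closed xe ye xy; have [on_e _] := De.
pose one_zero (u v : 'rV[R]_n) r := (dotv r u == 1) && (dotv r v == 0).
have dot_sumE : {in Phi, (fun r => dotv r (x + y) == 1) =1 predU (one_zero x y) (one_zero y x)}.
  move=> r rP /=; rewrite dotvDr /one_zero.
  case/orP: (allP closed r rP) => [Dr|/orth_allP orth_r].
    by apply: unit_sum_eq1; exact: D_root_dot_unit Dr _.
  by rewrite !orth_r // addr0 eqxx andbT orbb.
have := count_predUI (one_zero x y) (one_zero y x) Phi.
rewrite (count_closed_dot De closed xe ye xy) (count_closed_dot De closed ye xe) 1?eq_sym //.
rewrite [count (predI _ _) _](_ : _ = 0%N); last first.
  apply/eqP; rewrite -leqn0 leqNgt -has_count; apply/hasPn => r _ /=.
  by apply/negP => /andP[/andP[/eqP rx _] /andP[_ /eqP]]; rewrite rx; lra.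
by rewrite addn0 /valency (eq_in_count dot_sumE) => ->; lia.
Qed.

Lemma closed_frame_coxeter h e : coxeter_regular Phi h -> Dframe Phi e -> D_closed Phi e ->
  (1 < size e)%N -> h = (size e).-1.*2.
Proof.
move=> regPhi De closed size_e; have [[uniq_e _] rootD] := De.
have xe : e`_0 \in e by rewrite mem_nth // ltnW.
have ye : e`_1 \in e by rewrite mem_nth.
have xy : e`_0 != e`_1 by rewrite nth_uniq // ltnW.
have [sumP _] := rootD _ _ xe ye xy.
have := regPhi _ sumP; rewrite (closed_frame_valency De closed xe ye xy); lia.
Qed.

Lemma orth_nbrs_dot c x y z : c \in Phi -> dotv x c = 1 ->
  y \in orth_nbrs Phi c x -> z \in orth_nbrs Phi c x -> y != z ->
  dotv y z = 0 \/ dotv y z = 1.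
Proof.
move=> cP xc /orth_nbrsP[yP yc yx] /orth_nbrsP[zP zc zx] yz.
case yz_dot: _ / (root_dotP slPhi yP zP) => [yE|yE|||]; [| |by right| |by left].
- by rewrite yE eqxx in yz.
- by move: yc; rewrite yE dotvNl zc; lra.
have yE : y = c - z.
  apply: (root_dot_eq2 slPhi) => //; first by apply: root_sub; rewrite // dotvC.
  by rewrite dotvBr yc yz_dot; ring.
by move: yx; rewrite yE dotvBl zx (dotvC c) xc; lra.
Qed.

(* If no two neighbours of [c] orthogonal to [x] are orthogonal to each other, they
   form with [c] and [c - x] a family of vectors at mutual inner product 1. *)
Lemma orth_nbrs_size c x : c \in Phi -> x \in Phi -> dotv x c = 1 ->
  {in orth_nbrs Phi c x &, forall y z, dotv y z != 0} -> ((size (orth_nbrs Phi c x)).+2 <= n)%N.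
Proof.
move=> cP xP xc no_orth; have cx : dotv c x = 1 by rewrite dotvC.
set O := orth_nbrs Phi c x in no_orth *; pose simplex : seq 'rV[R]_n := [:: c, c - x & O].
have dot_O y z : y \in O -> z \in O -> y != z -> dotv y z = 1.
  move=> yO zO yz; have [yz0|//] := orth_nbrs_dot cP xc yO zO yz.
  by have := no_orth y z yO zO; rewrite yz0 eqxx.
have cxP : c - x \in Phi by exact: root_sub.
have dot_c y : y \in c - x :: O -> dotv c y = 1.
  rewrite inE => /orP[/eqP->|/orth_nbrsP[_ yc _]]; last by rewrite dotvC.
  by rewrite dotvBr (root_norm2 slPhi) // cx; ring.
have dot_cx y : y \in O -> dotv (c - x) y = 1.
  by case/orth_nbrsP=> _ yc yx; rewrite dotvBl (dotvC c) (dotvC x) yc yx subr0.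
apply: (@equiangular_size _ _ 2 1 simplex); rewrite ?ler01 ?ltr1n //.
- rewrite cons_uniq /= filter_uniq ?(simply_laced_uniq slPhi) // andbT.
  apply/andP; split; first apply/negP => /dot_c; last apply/negP => /dot_cx.
    by rewrite (root_norm2 slPhi) //; lra.
  by rewrite (root_norm2 slPhi) //; lra.
- move=> y; rewrite !inE => /or3P[/eqP->|/eqP->|/orth_nbrsP[yP _ _]];
  by rewrite (root_norm2 slPhi).
move=> y z; rewrite in_cons [z \in _]in_cons.
case/orP=> [/eqP->|yO] /orP[/eqP->|zO]; rewrite ?eqxx // => yz.
- exact: dot_c.
- by rewrite dotvC dot_c.
move: yO zO yz; rewrite !inE => /orP[/eqP->|yO] /orP[/eqP->|zO]; rewrite ?eqxx // => yz.
- exact: dot_cx.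
- by rewrite dotvC dot_cx.
- exact: dot_O.
Qed.

Lemma regular_D4 h : coxeter_regular Phi h -> (n.+1 < h)%N -> Phi != [::] ->
  exists2 e, Dframe Phi e & size e = 4%N.
Proof.
move=> regPhi lt_nh Phi_neq0.
have [c cP] := exists_mem Phi_neq0.
have n_gt0 := root_dim_gt0 slPhi cP.
have /hasP[x xP /eqP xc] : has (fun x => dotv x c == 1) Phi.
  by have := regPhi c cP; rewrite has_count /valency; lia.
set O := orth_nbrs Phi c x.
have size_O : (size O + 3 = h)%N.
  by have := regPhi c cP; rewrite (valency_orth_nbrs slPhi cP xP xc) -/O; lia.
have [/hasP[y yO /hasP[z zO /eqP yz]]|/hasPn no_orth] :=
    boolP (has (fun y => has (fun z => dotv y z == 0) O) O).
  have [yP yc yx] := orth_nbrsP _ _ _ _ yO; have [zP zc zx] := orth_nbrsP _ _ _ _ zO.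
  by eexists; first exact: (Dframe_star slPhi (And4 cP xP yP zP) (And3 xc yc zc) (And3 yx zx yz)).
have := orth_nbrs_size cP xP xc; rewrite -/O => size_le.
suff : ((size O).+2 <= n)%N by lia.
by apply: size_le => y z yO zO; have /hasPn := no_orth y yO; apply.
Qed.

Lemma D_closed_or_spinor h : coxeter_regular Phi h -> (n.+1 < h)%N -> Phi != [::] ->
  (exists e, [/\ Dframe Phi e, D_closed Phi e & h = (size e).-1.*2]) \/ has_spinor Phi.
Proof.
move=> regPhi lt_nh Phi_neq0; have [e4 De4 size4] := regular_D4 regPhi lt_nh Phi_neq0.
have [[e [De size_e closed]]|] := Dframe4_dichotomy slPhi De4 size4; last by right.
left; exists e; split=> //; apply: closed_frame_coxeter regPhi De closed _.
by apply: leq_trans size_e.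
Qed.

End ClosedFrames.

(** * Subsystems with a given base *)

Fixpoint idot (c g : seq int) : int :=
  match c, g with
  | x :: c', y :: g' => x * y + idot c' g'
  | _, _ => 0
  end.

Definition simple_refl (G : seq (seq int)) (c : seq int) (j : nat) : seq int :=
  set_nth 0 c j (c`_j - idot c (nth [::] G j)).

Definition unit_row (m i : nat) (z : int) : seq int :=
  [seq if t == i then z else 0 | t <- iota 0 m].

Definition add_row (m : nat) (c d : seq int) : seq int := [seq c`_t + d`_t | t <- iota 0 m].

Definition raise_level (G L : seq (seq int)) : seq (seq int) :=
  undup (flatten [seq [seq simple_refl G c j | j <- iota 0 (size G)
                                             & idot c (nth [::] G j) == -1] | c <- L]).

Fixpoint levels (G : seq (seq int)) (m : nat) (L : seq (seq int)) : seq (seq int) :=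
  if m is m'.+1 then L ++ levels G m' (raise_level G L) else [::].

(* The coordinates of the roots with respect to a base with Gram matrix [G]: the
   positive ones are obtained height by height, and have height less than [h]. *)
Definition coord_roots (G : seq (seq int)) (h : nat) : seq (seq int) :=
  let P := levels G h.-1 [seq unit_row (size G) j 1 | j <- iota 0 (size G)] in
  P ++ [seq map -%R c | c <- P].

Definition dots (G : seq (seq int)) (c : seq int) : seq int := [seq idot c g | g <- G].

Definition coord_roots_ok (G : seq (seq int)) (h : nat) : bool :=
  let S := coord_roots G h in
  [&& (0 < size G)%N, size S == (size G * h)%N, uniq [seq dots G c | c <- S] &
      (count (fun c => idot c (nth [::] G 0) == 1) S + 4 == h.*2)%N].

(* [theta] is the highest root and [rho2] the sum of the positive roots. *)
Definition highest_root_ok (G : seq (seq int)) (h : nat) (theta rho2 : seq int) : bool :=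
  let S := coord_roots G h in
  [&& all (fun c => all (fun j => simple_refl G c j \in S) (iota 0 (size G))) S,
      (theta \in S) && (size theta == size G), all (fun z => 0 < z) theta &
      all (fun g => (idot rho2 g == 2) && (size g == size G)) G].

Definition gram_sum (G G' : seq (seq int)) : seq (seq int) :=
  [seq g ++ nseq (size G') 0 | g <- G] ++ [seq nseq (size G) 0 ++ g | g <- G'].

Lemma idotE k c g : (size g <= k)%N -> idot c g = \sum_(i < k) c`_i * g`_i.
Proof.
elim: k c g => [|k IHk] [|x c] [|y g] //= size_g; rewrite ?big_ord0 //.
- by rewrite big1 // => i _; rewrite nth_nil mul0r.
- by rewrite big1 // => i _; rewrite nth_nil mul0r.
- by rewrite big1 // => i _; rewrite (nth_nil 0 i) mulr0.
- by rewrite big_ord_recl /= (IHk c g).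
Qed.

Section LinearCombinations.
Variables (R : realType) (n : nat).
Implicit Types (b : seq 'rV[R]_n) (c : seq int) (G : seq (seq int)).

Definition lincomb b c : 'rV[R]_n := \sum_(i < size b) (c`_i)%:~R *: b`_i.

Definition has_gram b G := [/\ size G = size b, all (fun g => size g == size b) G &
  forall i j, (i < size b)%N -> (j < size b)%N ->
    dotv b`_i b`_j = ((nth [::] G j)`_i)%:~R].

Lemma has_gram_size_row b G j : has_gram b G -> (j < size b)%N ->
  size (nth [::] G j) = size b.
Proof. by move=> [size_G /allP row_G _] lt_j; apply/eqP/row_G; rewrite mem_nth ?size_G. Qed.

Lemma dotv_lincomb b c v :
  dotv (lincomb b c) v = \sum_(i < size b) (c`_i)%:~R * dotv b`_i v.
Proof. by rewrite dotv_suml; apply: eq_bigr => i _; rewrite dotvZl. Qed.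

Lemma dotv_lincomb_nth b G c j : has_gram b G -> (j < size b)%N ->
  dotv (lincomb b c) b`_j = (idot c (nth [::] G j))%:~R.
Proof.
move=> gram_b lt_j; have [_ _ dot_b] := gram_b; rewrite dotv_lincomb.
rewrite (@idotE (size b)) ?(has_gram_size_row gram_b) // rmorph_sum /=.
by apply: eq_bigr => i _; rewrite dot_b // rmorphM.
Qed.

Lemma lincomb_set_nth b c j z : (j < size b)%N ->
  lincomb b (set_nth 0 c j (c`_j - z)) = lincomb b c - z%:~R *: b`_j.
Proof.
move=> lt_j; rewrite /lincomb (bigD1 (Ordinal lt_j)) //= [in RHS](bigD1 (Ordinal lt_j)) //=.
rewrite nth_set_nth /= eqxx addrAC rmorphB /= scalerBl; congr (_ + _).
by apply: eq_bigr => i ij; rewrite nth_set_nth /= ifN.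
Qed.

Lemma lincombN b c : lincomb b (map -%R c) = - lincomb b c.
Proof.
rewrite /lincomb -sumrN; apply: eq_bigr => i _; rewrite -scaleNr -rmorphN /=.
have [lt_i|le_i] := ltnP i (size c); first by rewrite (nth_map 0).
by rewrite [in LHS]nth_default ?size_map // [c`_i]nth_default // oppr0.
Qed.

Lemma lincomb_unit_row b i z : (i < size b)%N ->
  lincomb b (unit_row (size b) i z) = z%:~R *: b`_i.
Proof.
move=> lt_i; rewrite /lincomb (bigD1 (Ordinal lt_i)) //= big1 ?addr0 => [|t ti].
  by rewrite (nth_map 0%N) ?size_iota // nth_iota // add0n eqxx.
rewrite (nth_map 0%N) ?size_iota // nth_iota // add0n.
by rewrite (negbTE (ti : (t : nat) != i)) scale0r.
Qed.

Lemma lincomb_add_row b c d : lincomb b (add_row (size b) c d) = lincomb b c + lincomb b d.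
Proof.
rewrite /lincomb -big_split; apply: eq_bigr => i _ /=.
by rewrite (nth_map 0%N) ?size_iota // nth_iota // rmorphD scalerDl.
Qed.

Lemma has_gram_rcons b G r (v : seq int) : has_gram b G -> size v = size b ->
  dotv r r = 2 -> (forall i, (i < size b)%N -> dotv r b`_i = (v`_i)%:~R) ->
  has_gram (rcons b r) (rcons [seq rcons p.1 p.2 | p <- zip G v] (rcons v 2)).
Proof.
move=> gram_b size_v rr rb; have [size_G row_G dot_b] := gram_b.
have size_zipGv : size (zip G v) = size b by rewrite size_zip size_G size_v minnn.
split; first by rewrite !size_rcons size_map size_zipGv.
  rewrite all_rcons !size_rcons size_v eqxx /=; apply/allP => _ /mapP[[g z] gz ->] /=.
  rewrite size_rcons eqSS; apply: (allP row_G); move/(map_f fst): gz.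
  by rewrite -/(unzip1 _) unzip1_zip // size_G size_v.
have row_size := has_gram_size_row gram_b.
move=> i j; rewrite !size_rcons !ltnS leq_eqVlt => /orP[/eqP->|lt_i];
  rewrite leq_eqVlt => /orP[/eqP->|lt_j]; rewrite !nth_rcons ?ltnn ?eqxx size_map size_zipGv.
- by rewrite ltnn eqxx nth_rcons size_v ltnn eqxx rr.
- rewrite lt_j (nth_map ([::], 0)) ?size_zipGv //= nth_zip /= ?size_G ?size_v //.
  by rewrite nth_rcons row_size // ltnn eqxx rb.
- by rewrite lt_i ltnn eqxx nth_rcons size_v lt_i dotvC rb.
- rewrite lt_i lt_j (nth_map ([::], 0)) ?size_zipGv //= nth_zip /= ?size_G ?size_v //.
  by rewrite nth_rcons row_size // lt_i dot_b.
Qed.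

Lemma has_gram_cat b b' G G' : has_gram b G -> has_gram b' G' ->
  {in b & b', forall x y, dotv x y = 0} -> has_gram (b ++ b') (gram_sum G G').
Proof.
move=> gram_b gram_b' orth; have [size_G row_G dot_b] := gram_b.
have [size_G' row_G' dot_b'] := gram_b'.
have row_size := has_gram_size_row gram_b.
split; first by rewrite !size_cat !size_map size_G size_G'.
  rewrite all_cat !all_map size_cat; apply/andP; split; [move: row_G|move: row_G'];
  by apply: sub_all => g /eqP size_g; rewrite /= size_cat size_nseq size_g ?size_G ?size_G'.
have orth_nth i j : (i < size b)%N -> (j < size b')%N -> dotv b`_i b'`_j = 0.
  by move=> lt_i lt_j; rewrite orth ?mem_nth.
move=> i j; rewrite size_cat !nth_cat size_map size_G => lt_i lt_j.
have lt_sub k : (size b <= k)%N -> (k < size b + size b')%N -> (k - size b < size b')%N by lia.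
have [lt_jb|le_bj] := ltnP j (size b); rewrite (nth_map [::]) ?size_G ?size_G' ?lt_sub //;
  have [lt_ib|le_bi] := ltnP i (size b).
- by rewrite nth_cat row_size // lt_ib dot_b.
- by rewrite nth_cat row_size // ltnNge le_bi /= nth_nseq if_same dotvC orth_nth ?lt_sub.
- by rewrite nth_cat size_nseq lt_ib nth_nseq if_same orth_nth ?lt_sub.
- by rewrite nth_cat size_nseq ltnNge le_bi /= dot_b' ?lt_sub.
Qed.

Lemma has_gram_map_nth b G (p : seq nat) : has_gram b G -> all (fun i => i < size b)%N p ->
  has_gram [seq b`_i | i <- p] [seq [seq (nth [::] G j)`_i | i <- p] | j <- p].
Proof.
move=> [_ _ dot_b] /allP p_lt; split; first by rewrite !size_map.
  by apply/allP => _ /mapP[j _ ->]; rewrite !size_map.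
move=> i j; rewrite !size_map => lt_i lt_j.
by rewrite !(nth_map 0%N) // dot_b //; apply: p_lt; exact: mem_nth.
Qed.

Lemma dotv_lincomb_orthonormal e c d : orthonormal_seq e -> (size d <= size e)%N ->
  dotv (lincomb e c) (lincomb e d) = (idot c d)%:~R.
Proof.
move=> on_e size_d; rewrite dotv_lincomb (idotE _ size_d) rmorph_sum.
apply: eq_bigr => i _; rewrite rmorphM dotvC dotv_lincomb (bigD1 i) //= big1 => [|j ji].
  by rewrite orthonormal_nth // eqxx addr0 mulr1.
by rewrite orthonormal_nth // (negbTE (ji : (j : nat) != i)) mulr0.
Qed.

Lemma has_gram_lincomb e (B : seq (seq int)) :
  orthonormal_seq e -> all (fun l => size l <= size e)%N B ->
  has_gram [seq lincomb e l | l <- B] [seq [seq idot l l' | l <- B] | l' <- B].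
Proof.
move=> on_e /allP size_B; split; rewrite ?size_map //.
  by apply/allP => _ /mapP[l _ ->]; rewrite size_map.
move=> i j lt_i lt_j; rewrite !(nth_map [::]) // dotv_lincomb_orthonormal //.
by rewrite size_B ?mem_nth.
Qed.

Lemma lincombs_uniq b G S : has_gram b G -> uniq [seq dots G c | c <- S] ->
  uniq [seq lincomb b c | c <- S].
Proof.
move=> gram_b; have [size_G _ _] := gram_b.
rewrite -(map_inj_uniq (inj_map (@intr_inj R))) -map_comp => uniq_dots.
apply: (@map_uniq _ _ (fun v => [seq dotv v y | y <- b])).
rewrite -map_comp (eq_map (g := map intr \o dots G)) // => c /=.
apply: (@eq_from_nth _ 0) => [|j]; rewrite !size_map ?size_G // => lt_j.
rewrite !(nth_map 0) ?size_map ?size_G // (dotv_lincomb_nth c gram_b) //.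
by rewrite (nth_map [::]) ?size_G.
Qed.

End LinearCombinations.

(** * Minuscule extensions *)

Lemma exists_min (d : Order.disp_t) (T : eqType) (T' : orderType d) (f : T -> T') (s : seq T) :
  s != [::] -> exists2 x, x \in s & {in s, forall y, f x <= f y}%O.
Proof.
case: s => // x0 s _; pose f_nth (i : 'I_(size (x0 :: s))) := f (nth x0 (x0 :: s) i).
case: (@Order.TotalTheory.arg_minP _ T' _ ord0 predT f_nth) => // i _ min_i.
exists (nth x0 (x0 :: s) i); first exact: mem_nth.
by move=> y /(nthP x0)[j lt_j <-]; exact: (min_i (Ordinal lt_j)).
Qed.

Section Dominance.
Variables (R : realType) (n : nat) (Phi : seq 'rV[R]_n).
Hypothesis slPhi : simply_laced Phi.
Variables b T : seq 'rV[R]_n.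
Hypotheses (subT : {subset T <= Phi}) (subb : {subset b <= T}).
Hypothesis oppT : {in T, forall x, - x \in T}.
Hypothesis reflT : {in T & b, forall x y, x - dotv x y *: y \in T}.
Implicit Types (x y r : 'rV[R]_n) (theta : seq int).

(* It is a root minimizing the inner product with a dominant vector. *)
Lemma antidominant_root rho2 : {in b, forall y, dotv y rho2 = 2} ->
  ~~ all (fun r => (r \in T) || orth_all b r) Phi ->
  exists x, [/\ x \in Phi, x \notin T, ~~ orth_all b x &
                {in b, forall y, dotv x y \in [:: 0; -1]}].
Proof.
move=> rho2_b /allPn[r rP not_r].
pose Q := [seq x <- Phi | ~~ ((x \in T) || orth_all b x)].
have [|x] := @exists_min _ _ _ (fun x => dotv x rho2) Q.
  by apply/eqP => Q0; have : r \in Q; [rewrite mem_filter not_r|rewrite Q0].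
rewrite mem_filter negb_or => /andP[/andP[x_notT x_northb] xP] min_x.
exists x; split=> // y yb; have yT := subb yb; have yP := subT yT; move: min_x.
case xy: _ / (root_dotP slPhi xP yP) => [xE|xE|||] min_x; rewrite ?inE ?eqxx ?orbT //.
- by rewrite xE yT in x_notT.
- by rewrite xE oppT in x_notT.
have xyP := root_sub slPhi xP yP xy.
have xy_y : dotv (x - y) y = -1 by rewrite dotvBl xy (root_norm2 slPhi) //; ring.
have /min_x : x - y \in Q.
  rewrite mem_filter xyP andbT negb_or; apply/andP; split.
    apply: contra x_notT => xyT; have := reflT xyT yb.
    by rewrite xy_y scaleN1r opprK subrK.
  apply/negP => /orth_allP/(_ y yb)/eqP; rewrite xy_y oppr_eq0 oner_eq0 //.
by rewrite /= dotvBl (rho2_b y) // => le_rho2; exfalso; lra.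
Qed.

(* The inner product of [x] with the highest root is at least -1, so exactly one
   simple root, of coefficient 1 in the highest root, is not orthogonal to [x]. *)
Lemma antidominant_minuscule theta x : lincomb b theta \in T -> size theta = size b ->
  all (fun z : int => 0 < z) theta ->
  x \in Phi -> x \notin T -> ~~ orth_all b x -> {in b, forall y, dotv x y \in [:: 0; -1]} ->
  exists2 j, (j < size b)%N & theta`_j = 1 /\
    forall i, (i < size b)%N -> dotv x b`_i = - (i == j)%:R.
Proof.
move=> thetaT size_theta /allP theta_gt0 xP x_notT x_northb x_anti.
have theta_ge1 i : (i < size b)%N -> 1 <= (theta`_i)%:~R :> R.
  by move=> lt_i; rewrite -[1]/(1%:~R) ler_int; apply: theta_gt0; rewrite mem_nth ?size_theta.
have [j lt_j xj] : exists2 j, (j < size b)%N & dotv x b`_j = -1.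
  case/allPn: x_northb => y yb xy; exists (index y b); rewrite ?index_mem // nth_index //.
  by have := x_anti y yb; rewrite !inE (negbTE xy) => /eqP.
have x_nth i : (i < size b)%N -> dotv x b`_i \in [:: 0; -1].
  by move=> lt_i; rewrite x_anti ?mem_nth.
pose F (i : 'I_(size b)) := - ((theta`_i)%:~R * dotv x b`_i).
have F_ge0 i : 0 <= F i.
  have := theta_ge1 i (ltn_ord i); have := x_nth i (ltn_ord i).
  by rewrite /F !inE => /orP[]/eqP->; lra.
pose rest := \sum_(i < size b | i != Ordinal lt_j) F i.
have rest_ge0 : 0 <= rest by apply: sumr_ge0 => i _; exact: F_ge0.
have x_theta : dotv x (lincomb b theta) = - (theta`_j)%:~R - rest.
  rewrite dotvC dotv_lincomb (bigD1 (Ordinal lt_j)) //= dotvC xj mulrN1; congr (_ + _).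
  by rewrite -sumrN; apply: eq_bigr => i _; rewrite opprK dotvC.
have x_theta_ge : -1 <= dotv x (lincomb b theta).
  case: (root_dotP slPhi xP (subT thetaT)) => [xE|xE|||]; rewrite ?lerN10 ?lexx //; first by lra.
    by rewrite xE oppT in x_notT.
  by lra.
have theta_j := theta_ge1 j lt_j.
exists j => //; split; first by apply/eqP; rewrite -(eqr_int R); apply/eqP; lra.
have /eqP : rest = 0 by lra.
rewrite psumr_eq0 => [/allP rest0 i lt_i|i _]; last exact: F_ge0.
have [->|ij] := eqVneq i j; first by rewrite xj.
have /implyP/(_ ij) := rest0 (Ordinal lt_i) (mem_index_enum _).
rewrite /F /= oppr_eq0 mulf_eq0 => /orP[/eqP theta0|/eqP->]; last by rewrite oppr0.
by have := theta_ge1 i lt_i; rewrite theta0 ler10.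
Qed.

End Dominance.

Section BasedSubsystem.
Variables (R : realType) (n : nat) (Phi : seq 'rV[R]_n).
Hypothesis slPhi : simply_laced Phi.
Variables (b : seq 'rV[R]_n) (G : seq (seq int)) (h : nat).
Hypotheses (subb : {subset b <= Phi}) (gram_b : has_gram b G).
Implicit Types (c theta : seq int).

Let size_G : size G = size b. Proof. by case: gram_b. Qed.

Definition subsystem : seq 'rV[R]_n := [seq lincomb b c | c <- coord_roots G h].

Lemma lincomb_simple_refl c j : (j < size b)%N ->
  lincomb b (simple_refl G c j) = lincomb b c - dotv (lincomb b c) b`_j *: b`_j.
Proof. by move=> lt_j; rewrite (dotv_lincomb_nth _ gram_b) // lincomb_set_nth. Qed.

Lemma subsystem_sub : {subset subsystem <= Phi}.
Proof.
suff levelsP m L : {in L, forall c, lincomb b c \in Phi} ->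
    {in levels G m L, forall c, lincomb b c \in Phi}.
  have posP c : c \in levels G h.-1 [seq unit_row (size G) j 1 | j <- iota 0 (size G)] ->
      lincomb b c \in Phi.
    apply: levelsP => d /mapP[j]; rewrite mem_iota size_G => /andP[_ lt_j] ->.
    by rewrite lincomb_unit_row // scale1r subb // mem_nth.
  move=> _ /mapP[c cS ->]; move: cS; rewrite mem_cat => /orP[/posP //|/mapP[d /posP dP ->]].
  by rewrite lincombN (root_oppE slPhi).
elim: m L => //= m IHm L LP c; rewrite mem_cat => /orP[/LP//|]; apply: IHm => {}c.
rewrite mem_undup => /flattenP[_ /mapP[d dL ->] /mapP[j]].
rewrite mem_filter mem_iota size_G => /and3P[_ _ lt_j] ->.
by rewrite lincomb_simple_refl //; apply: root_sub_dotv => //; [exact: LP|rewrite subb ?mem_nth].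
Qed.

Hypothesis G_ok : coord_roots_ok G h.

Lemma mem_subsystem_base : {subset b <= subsystem}.
Proof.
move=> y yb; have lt_y : (index y b < size b)%N by rewrite index_mem.
have yE : lincomb b (unit_row (size b) (index y b) 1) = y.
  by rewrite lincomb_unit_row // scale1r nth_index.
rewrite -{}yE map_f // mem_cat.
case/and4P: G_ok => _ _ _ /eqP h_eq; have -> : h.-1 = h.-2.+1 by lia.
by rewrite mem_cat -size_G (map_f (fun j => unit_row (size G) j 1)) // mem_iota size_G.
Qed.

Lemma subsystem_uniq : uniq subsystem.
Proof. by case/and4P: G_ok => _ _ uniq_dots _; exact: lincombs_uniq gram_b uniq_dots. Qed.

Lemma size_subsystem : size subsystem = (size b * h)%N.
Proof. by case/and4P: G_ok => _ /eqP size_S _ _; rewrite size_map size_S size_G. Qed.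

Lemma count_subsystem : (count (fun x => dotv x b`_0 == 1%R) subsystem + 4 = h.*2)%N.
Proof.
case/and4P: G_ok => G_gt0 _ _ /eqP <-; rewrite size_G in G_gt0; rewrite count_map.
congr (_ + _)%N; apply: eq_count => c /=.
by rewrite (dotv_lincomb_nth _ gram_b) // -[1]/(1%:~R) eqr_int.
Qed.

Definition splits := all (fun r => (r \in subsystem) || orth_all b r) Phi.

Lemma splits_coxeter h' : coxeter_regular Phi h' -> splits -> h' = h.
Proof.
move=> regPhi /allP split_b; have b0b : b`_0 \in b.
  by rewrite mem_nth // -size_G; case/and4P: G_ok.
have := regPhi _ (subb b0b); rewrite /valency -size_filter.
rewrite (perm_size (s2 := [seq x <- subsystem | dotv x b`_0 == 1])).
  by rewrite size_filter count_subsystem; lia.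
apply: uniq_perm; rewrite ?filter_uniq ?subsystem_uniq ?(simply_laced_uniq slPhi) // => x.
rewrite !mem_filter; case: eqP => //= x1; apply/idP/idP => [xP|/subsystem_sub //].
case/orP: (split_b x xP) => // /orth_allP/(_ _ b0b).
by rewrite x1 => /eqP; rewrite oner_eq0.
Qed.

Lemma splits_or_minuscule theta rho2 : highest_root_ok G h theta rho2 ->
  splits \/ exists2 j, (j < size b)%N & theta`_j = 1 /\
    exists2 r, r \in Phi & forall i, (i < size b)%N -> dotv r b`_i = - (i == j)%:R.
Proof.
case/and4P=> /allP reflS /andP[thetaS /eqP size_theta] theta_gt0 /allP rhoG.
have b_nth y : y \in b -> exists2 j, (j < size b)%N & y = b`_j.
  by move=> yb; exists (index y b); rewrite ?index_mem ?nth_index.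
have opp_sub : {in subsystem, forall x, - x \in subsystem}.
  move=> _ /mapP[c cS ->]; rewrite -lincombN map_f //; move: cS.
  rewrite !mem_cat => /orP[cP|/mapP[d dP ->]]; first by rewrite map_f ?orbT.
  by rewrite (mapK opprK) dP.
have refl_sub : {in subsystem & b, forall x y, x - dotv x y *: y \in subsystem}.
  move=> _ _ /mapP[c cS ->] /b_nth[j lt_j ->]; rewrite -lincomb_simple_refl // map_f //.
  by apply: (allP (reflS c cS)); rewrite mem_iota size_G.
have dot_rho2 : {in b, forall y, dotv y (lincomb b rho2) = 2}.
  move=> _ /b_nth[j lt_j ->]; rewrite dotvC (dotv_lincomb_nth _ gram_b) //.
  by have /andP[/eqP-> _] := rhoG _ (mem_nth [::] (ltac:(by rewrite size_G) : j < size G)%N).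
have [|not_split] := boolP splits; [by left|right].
have [x [xP x_notT x_northb x_anti]] :=
  antidominant_root slPhi subsystem_sub mem_subsystem_base opp_sub refl_sub dot_rho2 not_split.
have [|j lt_j [theta_j x_nth]] := antidominant_minuscule slPhi subsystem_sub opp_sub
  (map_f _ thetaS) _ theta_gt0 xP x_notT x_northb x_anti; first by rewrite size_theta.
by exists j => //; split=> //; exists x.
Qed.

End BasedSubsystem.

(** * The exceptional systems *)

(* The nodes of the diagrams are numbered as in Bourbaki. *)
Definition gramE8 : seq (seq int) :=
  [:: [:: 2; 0; -1; 0; 0; 0; 0; 0];
      [:: 0; 2; 0; -1; 0; 0; 0; 0];
      [:: -1; 0; 2; -1; 0; 0; 0; 0];
      [:: 0; -1; -1; 2; -1; 0; 0; 0];
      [:: 0; 0; 0; -1; 2; -1; 0; 0];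
      [:: 0; 0; 0; 0; -1; 2; -1; 0];
      [:: 0; 0; 0; 0; 0; -1; 2; -1];
      [:: 0; 0; 0; 0; 0; 0; -1; 2]].
Definition gramE7 : seq (seq int) := [seq take 7 g | g <- take 7 gramE8].
Definition gramE6 : seq (seq int) := [seq take 6 g | g <- take 6 gramE8].

Definition highestE6 : seq int := [:: 1; 2; 2; 3; 2; 1].
Definition highestE7 : seq int := [:: 2; 2; 3; 4; 3; 2; 1].
Definition highestE8 : seq int := [:: 2; 3; 4; 6; 5; 4; 3; 2].

Lemma gramE6_ok : coord_roots_ok gramE6 12.
Proof. by vm_compute. Qed.

Lemma gramE7_ok : coord_roots_ok gramE7 18.
Proof. by vm_compute. Qed.

Lemma gramE8_ok : coord_roots_ok gramE8 30.
Proof. by vm_compute. Qed.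

Lemma highestE6_ok : highest_root_ok gramE6 12 highestE6 [:: 16; 22; 30; 42; 30; 16].
Proof. by vm_compute. Qed.

Lemma highestE7_ok : highest_root_ok gramE7 18 highestE7 [:: 34; 49; 66; 96; 75; 52; 27].
Proof. by vm_compute. Qed.

Lemma highestE8_ok :
  highest_root_ok gramE8 30 highestE8 [:: 92; 136; 182; 270; 220; 168; 114; 58].
Proof. by vm_compute. Qed.

Section ExceptionalChain.
Variables (R : realType) (n : nat) (Phi : seq 'rV[R]_n) (h : nat).
Hypotheses (slPhi : simply_laced Phi) (regPhi : coxeter_regular Phi h).
Implicit Types (r : 'rV[R]_n) (b e : seq 'rV[R]_n) (G : seq (seq int)).

Definition has_base G := exists2 b, {subset b <= Phi} & has_gram b G.

Lemma has_base_rcons b G (v : seq int) r : {subset b <= Phi} -> has_gram b G ->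
  size v = size b -> r \in Phi -> (forall i, (i < size b)%N -> dotv r b`_i = (v`_i)%:~R) ->
  has_base (rcons [seq rcons p.1 p.2 | p <- zip G v] (rcons v 2)).
Proof.
move=> subb gram_b size_v rP rb; exists (rcons b r).
  by move=> x; rewrite mem_rcons inE => /orP[/eqP->|/subb].
by apply: has_gram_rcons; rewrite ?(root_norm2 slPhi).
Qed.

Lemma spinor_E6 : has_spinor Phi -> has_base gramE6.
Proof.
move=> [r rP [e [De size_e r_half]]].
have dot_nth i j : (i < 5)%N -> (j < 5)%N -> dotv e`_i e`_j = (i == j)%:R.
  by rewrite -size_e; exact: orthonormal_nth De.1.
have half_nth i : (i < 5)%N -> dotv r e`_i = 2^-1.
  by rewrite -size_e => lt_i; rewrite r_half ?mem_nth.
have half_nthC i : (i < 5)%N -> dotv e`_i r = 2^-1 by move=> ?; rewrite dotvC half_nth.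
have sub_nth i j : (i < 5)%N -> (j < 5)%N -> i != j -> e`_i - e`_j \in Phi.
  by rewrite -size_e => lt_i lt_j ij; have [] := Dframe_nth De lt_i lt_j ij.
have [e01 _] := @Dframe_nth _ _ _ _ 0 1 De ltac:(by rewrite size_e) ltac:(by rewrite size_e) isT.
exists [:: - r; e`_0 - e`_1; e`_0 + e`_1; e`_2 - e`_0; e`_3 - e`_2; e`_4 - e`_3].
  move=> x; rewrite !inE => /or4P[|||/or3P[]]/eqP->; rewrite ?(root_oppE slPhi) //;
  exact: sub_nth.
split=> // i j; do 6?[case: i => [|i] //]; do 6?[case: j => [|j] //] => _ _ /=.
all: by rewrite !dotv_bilin ?dot_nth ?half_nth ?half_nthC ?(root_norm2 slPhi) //=; field.
Qed.

Lemma E6_dichotomy : has_base gramE6 -> h = 12%N \/ has_base gramE7.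
Proof.
move=> [b subb gram_b]; have [/esym/= size_b _ _] := gram_b.
have [split_b|[j lt_j [theta_j [r rP rb]]]] :=
  splits_or_minuscule slPhi subb gram_b gramE6_ok highestE6_ok.
  by left; exact: (splits_coxeter slPhi subb gram_b gramE6_ok regPhi).
right; rewrite size_b in lt_j rb.
(* The opposition involution of the diagram E6 exchanges the two minuscule nodes. *)
have [b' [subb' gram_b' size_b' rb']] : exists b', [/\ {subset b' <= Phi}, has_gram b' gramE6,
    size b' = 6%N & forall i, (i < 6)%N -> dotv r b'`_i = - (i == 5%N)%:R].
  have [jE|jE] : j = 0%N \/ j = 5%N.
    by case: j lt_j theta_j {rb} => [|[|[|[|[|[|j]]]]]] //; [left|right].
  - pose p := [:: 5; 1; 4; 3; 2; 0]%N.
    have p_lt : all (fun i => i < size b)%N p by rewrite size_b.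
    exists [seq b`_i | i <- p]; split=> //; last first.
      by rewrite jE in rb; move=> [|[|[|[|[|[|i]]]]]] //= _; rewrite rb.
    - exact: (has_gram_map_nth gram_b p_lt).
    - by move=> _ /mapP[i ip ->]; rewrite subb ?mem_nth //; exact: (allP p_lt).
  - by exists b; split=> // i lt_i; rewrite rb // jE.
apply: (has_base_rcons subb' gram_b' (v := [:: 0; 0; 0; 0; 0; -1]) _ rP); rewrite size_b' //.
by move=> [|[|[|[|[|[|i]]]]]] // lt_i; rewrite rb' //= oppr0.
Qed.

Lemma E7_dichotomy : has_base gramE7 -> h = 18%N \/ has_base gramE8.
Proof.
move=> [b subb gram_b]; have [/esym/= size_b _ _] := gram_b.
have [split_b|[j lt_j [theta_j [r rP rb]]]] :=
  splits_or_minuscule slPhi subb gram_b gramE7_ok highestE7_ok.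
  by left; exact: (splits_coxeter slPhi subb gram_b gramE7_ok regPhi).
right; rewrite size_b in lt_j rb.
have jE : j = 6%N by case: j lt_j theta_j {rb} => [|[|[|[|[|[|[|j]]]]]]].
apply: (has_base_rcons subb gram_b (v := [:: 0; 0; 0; 0; 0; 0; -1]) _ rP); rewrite size_b //.
by rewrite jE in rb; move=> [|[|[|[|[|[|[|i]]]]]]] // lt_i; rewrite rb //= oppr0.
Qed.

Lemma E8_splits b : {subset b <= Phi} -> has_gram b gramE8 -> splits Phi b gramE8 30.
Proof.
move=> subb gram_b; have [/esym/= size_b _ _] := gram_b.
have [//|[j lt_j [theta_j _]]] := splits_or_minuscule slPhi subb gram_b gramE8_ok highestE8_ok.
by rewrite size_b in lt_j; case: j lt_j theta_j => [|[|[|[|[|[|[|[|j]]]]]]]].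
Qed.

Lemma spinor_classification : has_spinor Phi ->
  [\/ h = 12%N /\ has_base gramE6, h = 18%N /\ has_base gramE7 | h = 30%N /\ has_base gramE8].
Proof.
move=> /spinor_E6 baseE6; have [h12|baseE7] := E6_dichotomy baseE6; first by constructor 1.
have [h18|[b subb gram_b]] := E7_dichotomy baseE7; first by constructor 2.
constructor 3; split; last by exists b.
exact: (splits_coxeter slPhi subb gram_b gramE8_ok regPhi (E8_splits subb gram_b)).
Qed.

Lemma coxeter_classification : (n.+1 < h)%N -> Phi != [::] ->
  [\/ exists e, [/\ Dframe Phi e, D_closed Phi e & h = (size e).-1.*2],
      h = 12%N /\ has_base gramE6, h = 18%N /\ has_base gramE7 | h = 30%N /\ has_base gramE8].
Proof.
move=> lt_nh Phi_neq0.
have [D|/spinor_classification[]] := D_closed_or_spinor slPhi regPhi lt_nh Phi_neq0.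
- by constructor 1.
- by constructor 2.
- by constructor 3.
- by constructor 4.
Qed.

Lemma exceptional_classification : (1 < n)%N -> (n.*2 <= h)%N -> Phi != [::] ->
  [\/ h = 12%N /\ has_base gramE6, h = 18%N /\ has_base gramE7 | h = 30%N /\ has_base gramE8].
Proof.
move=> n_gt1 le_nh /(coxeter_classification (_ : n.+1 < h)%N)[|[e [De _ hE]]|?|?|?]; first lia.
- by have := orthonormal_size De.1; lia.
- by constructor 1.
- by constructor 2.
- by constructor 3.
Qed.

Lemma coxeter_admissible : Phi != [::] -> admissible n h.
Proof.
move=> Phi_neq0; have [a aP] := exists_mem Phi_neq0.
have n_gt0 := root_dim_gt0 slPhi aP; have h_gt1 : (1 < h)%N by have := regPhi aP; lia.
rewrite /admissible n_gt0 h_gt1 /=; have [//|lt_nh /=] := leqP h n.+1.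
have [[e [De _ hE]]|spin] := D_closed_or_spinor slPhi regPhi lt_nh Phi_neq0.
  by have size_e := orthonormal_size De.1; apply/orP; left; lia.
have n_gt4 : (4 < n)%N by case: spin => r _ [e [De <- _]]; exact: orthonormal_size De.1.
rewrite n_gt4 !inE; apply/orP; right.
by have [[-> _]|[-> _]|[-> _]] := spinor_classification spin; rewrite ?eqxx ?orbT.
Qed.

End ExceptionalChain.

(** * Isometries *)

Section Isometry.
Variable R : realType.

Lemma gram_isometry (n m k : nat) (B : 'M[R]_(k, n)) (B' : 'M[R]_(k, m)) :
  row_full B -> B *m B^T = B' *m B'^T ->
  exists2 M : 'M[R]_(n, m), M *m M^T = 1%:M & B *m M = B'.
Proof.
move=> full_B gramE; have pinvB : pinvmx B *m B = 1%:M by exact: mulVpmx.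
exists (pinvmx B *m B').
  rewrite trmx_mul mulmxA -(mulmxA (pinvmx B)) -gramE mulmxA pinvB mul1mx -trmx_mul pinvB.
  by rewrite trmx1.
apply/eqP; rewrite -subr_eq0; apply/eqP; pose X := B *m pinvmx B - 1%:M.
have XB : X *m B = 0 by rewrite mulmxBl mul1mx -mulmxA pinvB mulmx1 subrr.
have -> : B *m (pinvmx B *m B') - B' = X *m B' by rewrite mulmxBl mul1mx mulmxA.
have XB'_norm : (X *m B') *m (X *m B')^T = 0.
  by rewrite trmx_mul mulmxA -(mulmxA X) -gramE mulmxA XB !mul0mx.
apply/row_matrixP => i; rewrite row0; apply/eqP; rewrite -dotv_eq0.
move/matrixP/(_ i i): XB'_norm; rewrite [RHS]mxE => <-; apply/eqP.
by rewrite dotvE [in RHS]mxE; apply: eq_bigr => j _; rewrite !mxE.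
Qed.

Lemma lincomb_mulmx (n m : nat) (b : seq 'rV[R]_n) (b' : seq 'rV[R]_m) (M : 'M_(n, m)) c :
  size b = size b' -> (forall i, (i < size b)%N -> b`_i *m M = b'`_i) ->
  lincomb b c *m M = lincomb b' c.
Proof.
move=> size_b bM; rewrite /lincomb -size_b mulmx_suml; apply: eq_bigr => i _.
by rewrite -scalemxAl bM.
Qed.

Lemma isometry_inj (n m : nat) (M : 'M[R]_(n, m)) :
  M *m M^T = 1%:M -> injective (fun x : 'rV[R]_n => x *m M).
Proof. by move=> MM x y xy; rewrite -[x]mulmx1 -MM mulmxA xy -mulmxA MM mulmx1. Qed.

Lemma rs_equiv_gram (n m : nat) (Phi b : seq 'rV[R]_n) (Psi b' : seq 'rV[R]_m) G S :
  spans Phi -> has_gram b G -> has_gram b' G ->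
  Phi =i [seq lincomb b c | c <- S] -> Psi =i [seq lincomb b' c | c <- S] -> rs_equiv Phi Psi.
Proof.
move=> spPhi [size_G _ dot_b] [size_G' _ dot_b'] PhiE PsiE.
have size_b : size b = size b' by rewrite -size_G.
pose B' := \matrix_(i < size b) b'`_i.
have full_B : row_full (rows_mx b).
  rewrite /row_full eqn_leq rank_leq_col /= -{1}spPhi; apply: mxrankS.
  apply/row_subP => i; rewrite rowK.
  have := mem_nth 0 (ltn_ord i); rewrite PhiE => /mapP[c _ ->].
  rewrite /lincomb summx_sub // => j _; rewrite scalemx_sub //.
  by have -> : b`_j = row j (rows_mx b) by [rewrite rowK]; exact: row_sub.
have gramE : rows_mx b *m (rows_mx b)^T = B' *m B'^T.
  rewrite rows_mx_gram; apply/matrixP => i j; rewrite !mxE dot_b // -dot_b' -?size_b //.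
  by rewrite dotvE; apply: eq_bigr => k _; rewrite !mxE.
have [M MM BM] := gram_isometry full_B gramE.
have bM i : (i < size b)%N -> b`_i *m M = b'`_i.
  by move=> lt_i; have /(congr1 (row (Ordinal lt_i))) := BM; rewrite row_mul !rowK.
have lincombM c := lincomb_mulmx c size_b bM.
exists M; split=> // y; rewrite PsiE; apply/mapP/mapP => [[c cS ->]|[x]].
  by exists (lincomb b c); [rewrite PhiE map_f|rewrite lincombM].
by rewrite PhiE => /mapP[c cS ->] ->; exists c; rewrite ?lincombM.
Qed.

Definition modelled (m : nat) (Psi : seq 'rV[R]_m) (G : seq (seq int)) (h : nat) :=
  coord_roots_ok G h /\ exists2 b, has_gram b G & Psi =i subsystem b G h.

Section Identification.
Variables (n : nat) (Phi : seq 'rV[R]_n) (h : nat).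
Hypotheses (slPhi : simply_laced Phi) (spPhi : spans Phi).
Hypotheses (regPhi : coxeter_regular Phi h) (sizePhi : size Phi = (n * h)%N).

Lemma has_base_rs_equiv m (Psi : seq 'rV[R]_m) G : modelled Psi G h -> size G = n ->
  has_base Phi G -> rs_equiv Phi Psi.
Proof.
move=> [G_ok [b' gram_b' PsiE]] size_G [b subb gram_b].
apply: (rs_equiv_gram spPhi gram_b gram_b') PsiE => x.
have subE := subsystem_sub slPhi subb gram_b (h := h).
have [|_ <- //] := uniq_min_size (subsystem_uniq gram_b G_ok) subE.
by rewrite (size_subsystem gram_b G_ok) sizePhi; case: gram_b => <- _ _; rewrite size_G.
Qed.

Lemma modelled_parameters m (Psi : seq 'rV[R]_m) G k : modelled Psi G k -> rs_equiv Phi Psi ->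
  n = size G /\ h = k.
Proof.
move=> [G_ok [b gram_b PsiE]] [M [MM PhiM]]; have [size_G _ _] := gram_b.
have perm_sub : perm_eq [seq x *m M | x <- Phi] (subsystem b G k).
  apply: uniq_perm => [||y]; last by rewrite -PhiM PsiE.
    by rewrite (map_inj_uniq (isometry_inj MM)) (simply_laced_uniq slPhi).
  exact: subsystem_uniq gram_b G_ok.
have size_eq : (n * h = size G * k)%N.
  rewrite -sizePhi -(size_map (fun x => x *m M)) (perm_size perm_sub).
  by rewrite (size_subsystem gram_b G_ok) size_G.
have b0b : b`_0 \in b by rewrite mem_nth // -size_G; case/and4P: G_ok.
have := mem_subsystem_base gram_b G_ok b0b; rewrite -PsiE PhiM => /mapP[a aP aE].
have hE : h = k.
  have := regPhi aP; have := count_subsystem gram_b G_ok.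
  rewrite -(permP perm_sub) count_map aE.
  rewrite (eq_count (a2 := fun x => dotv x a == 1)) => [|x /=]; last by rewrite dotv_mulmx.
  by rewrite -/(valency Phi a); lia.
split=> //; have h_gt1 : (1 < h)%N by have := regPhi aP; lia.
by apply/eqP; rewrite -(eqn_pmul2r (ltnW h_gt1)) size_eq hE.
Qed.

Lemma rs_equiv_modelled m (Psi : seq 'rV[R]_m) G k : modelled Psi G k ->
  (n = size G -> h = k -> has_base Phi G) ->
  rs_equiv Phi Psi <-> (n, h) = (size G, k).
Proof.
move=> modelPsi base_G; split=> [/(modelled_parameters modelPsi)[-> ->] //|[nE hE]].
by apply: has_base_rs_equiv (base_G nE hE); rewrite ?hE.
Qed.

End Identification.

End Isometry.

(** * Coordinates of the standard root systems *)

Section HalfRows.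
Variables (R : realType) (m : nat).
Implicit Types (l : seq int) (B L G : seq (seq int)).

(* Integral coordinates are doubled, so as to represent half-integers. *)
Definition half_row l : 'rV[R]_m := \row_i ((l`_i)%:~R / 2).

Definition comb_rows B (c : seq int) : seq int :=
  [seq idot c [seq l`_t | l <- B] | t <- iota 0 m].

Definition same_rows L L' := all (mem L') L && all (mem L) L'.

Lemma dotv_half_row l l' : (size l' <= m)%N ->
  dotv (half_row l) (half_row l') = (idot l l')%:~R / 4.
Proof.
move=> size_l'; rewrite dotvE (idotE _ size_l') rmorph_sum mulr_suml.
by apply: eq_bigr => i _; rewrite !mxE rmorphM /=; field.
Qed.

Lemma lincomb_half_row B c : all (fun l => size l == m) B ->
  lincomb (map half_row B) c = half_row (comb_rows B c).
Proof.
move=> /allP size_B; apply/rowP => t; rewrite /lincomb summxE mxE size_map.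
rewrite (nth_map 0%N) ?size_iota // nth_iota // add0n (@idotE (size B)) ?size_map //.
rewrite rmorph_sum mulr_suml; apply: eq_bigr => i _.
by rewrite !mxE !(nth_map [::]) // mxE rmorphM mulrA.
Qed.

Lemma has_gram_half_row B G : all (fun l => size l == m) B ->
  [seq [seq idot x y | x <- B] | y <- B] = [seq [seq 4 * z | z <- g] | g <- G] ->
  has_gram (map half_row B) G.
Proof.
move=> /allP size_B gramE.
have size_G : size G = size B by have /(congr1 size) := gramE; rewrite !size_map.
have rowE j : (j < size B)%N ->
    [seq idot x (nth [::] B j) | x <- B] = [seq 4 * z | z <- nth [::] G j].
  move=> lt_j; have /(congr1 (fun s => nth [::] s j)) := gramE.
  by rewrite !(nth_map [::]) ?size_G.
have size_row j : (j < size B)%N -> size (nth [::] G j) = size B.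
  by move=> /rowE/(congr1 size); rewrite !size_map.
split; rewrite ?size_map //.
  by apply/allP => g /(nthP [::])[j]; rewrite size_G => lt_j <-; rewrite size_row.
move=> i j lt_i lt_j; rewrite !(nth_map [::]) // dotv_half_row; last first.
  by rewrite (eqP (size_B _ (mem_nth _ lt_j))).
have /(congr1 (fun s => s`_i)) := rowE j lt_j.
by rewrite (nth_map [::]) // (nth_map 0) ?size_row // => ->; rewrite rmorphM /=; field.
Qed.

Definition rows_model_ok L B G (h : nat) :=
  [&& all (fun l => size l == m) B,
      [seq [seq idot x y | x <- B] | y <- B] == [seq [seq 4 * z | z <- g] | g <- G],
      same_rows L [seq comb_rows B c | c <- coord_roots G h] & coord_roots_ok G h].

Lemma modelled_rows (Psi : seq 'rV[R]_m) L B G h :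
  Psi =i map half_row L -> rows_model_ok L B G h -> modelled Psi G h.
Proof.
move=> PsiE /and4P[size_B /eqP gramE /andP[/allP subL /allP supL] G_ok].
split=> //; exists (map half_row B); first exact: has_gram_half_row.
move=> x; rewrite PsiE; apply/mapP/mapP => [[l lL ->]|[c cS ->]].
  by have /mapP[c cS ->] := subL l lL; exists c; rewrite ?lincomb_half_row.
by exists (comb_rows B c); [exact/supL/map_f|rewrite lincomb_half_row].
Qed.

Lemma filter_orth_rows (Psi : seq 'rV[R]_m) L l : (size l <= m)%N -> Psi =i map half_row L ->
  [seq x <- Psi | dotv x (half_row l) == 0] =i map half_row [seq l' <- L | idot l' l == 0].
Proof.
move=> size_l PsiE x.
have dot_eq0 l' : (dotv (half_row l') (half_row l) == 0) = (idot l' l == 0).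
  by rewrite dotv_half_row // mulf_eq0 invr_eq0 (pnatr_eq0 _ 4) orbF intr_eq0.
rewrite mem_filter PsiE; apply/andP/mapP => [[x0 /mapP[l' l'L xE]]|[l']].
  by exists l' => //; rewrite mem_filter l'L andbT -dot_eq0 -xE.
by rewrite mem_filter => /andP[l'0 l'L] ->; rewrite dot_eq0 map_f.
Qed.

End HalfRows.

Arguments half_row {R m}.

Section StandardRows.
Variable R : realType.

Lemma half_row_add m c d : half_row (add_row m c d) = half_row c + half_row d :> 'rV[R]_m.
Proof.
apply/rowP => t; rewrite !mxE (nth_map 0%N) ?size_iota // nth_iota // add0n.
by rewrite rmorphD mulrDl.
Qed.

Lemma half_row_unit m (i : 'I_m) (z : int) : half_row (unit_row m i (2 * z)) = z%:~R *: ev R i.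
Proof.
apply/rowP => t; rewrite !mxE (nth_map 0%N) ?size_iota // nth_iota // add0n /=.
have [->|ti] := eqVneq t i; first by rewrite eqxx mulr1 rmorphM /=; field.
by rewrite (negbTE (ti : (t : nat) != i)) mul0r mulr0.
Qed.

Definition rowsA k : seq (seq int) :=
  [seq add_row k.+1 (unit_row k.+1 p.1 2) (unit_row k.+1 p.2 (-2)) |
   p <- [seq (i, j) | i <- iota 0 k.+1, j <- iota 0 k.+1] & p.1 != p.2].

Lemma mem_pairs k (P : rel nat) (i j : nat) :
  ((i, j) \in [seq p <- [seq (i, j) | i <- iota 0 k, j <- iota 0 k] | P p.1 p.2]) =
  [&& P i j, (i < k)%N & (j < k)%N].
Proof.
rewrite mem_filter; congr (_ && _); apply/allpairsP/andP => [[[i' j']]|[lt_i lt_j]].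
  by rewrite !mem_iota => -[lt_i lt_j [-> ->]].
by exists (i, j); rewrite !mem_iota.
Qed.

Lemma rsA_rows k : rsA R k =i map half_row (rowsA k).
Proof.
move=> x; rewrite -map_comp; apply/mapP/mapP => [[[i j]]|[[i j]]].
  rewrite mem_enum => ij ->; exists (i : nat, j : nat).
    by rewrite (mem_pairs _ (fun i j => i != j)) !ltn_ord !andbT.
  by rewrite /= half_row_add (half_row_unit i 1) (half_row_unit j (-1)) scale1r scaleN1r.
rewrite (mem_pairs _ (fun i j => i != j)) => /and3P[ij lt_i lt_j] ->.
exists (Ordinal lt_i, Ordinal lt_j); first by rewrite mem_enum.
rewrite /= half_row_add (half_row_unit (Ordinal lt_i) 1) (half_row_unit (Ordinal lt_j) (-1)).
by rewrite scale1r scaleN1r.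
Qed.

Definition rowsD k : seq (seq int) :=
  flatten [seq [seq add_row k (unit_row k p.1 s.1) (unit_row k p.2 s.2) |
                s <- [:: (2, 2); (2, -2); (-2, 2); (-2, -2)] : seq (int * int)] |
   p <- [seq (i, j) | i <- iota 0 k, j <- iota 0 k] & (p.1 < p.2)%N].

Lemma rsD_rows k : rsD R k =i map half_row (rowsD k).
Proof.
have quadE (i j : 'I_k) :
    [:: ev R i + ev R j; ev R i - ev R j; - ev R i + ev R j; - ev R i - ev R j] =
    map half_row [seq add_row k (unit_row k i s.1) (unit_row k j s.2) |
                    s <- [:: (2, 2); (2, -2); (-2, 2); (-2, -2)] : seq (int * int)].
  rewrite /= !half_row_add (half_row_unit i 1) (half_row_unit i (-1)).
  by rewrite (half_row_unit j 1) (half_row_unit j (-1)) !scale1r !scaleN1r.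
move=> x; rewrite /rowsD map_flatten -map_comp; apply/flattenP/flattenP => -[s /mapP[[i j]]].
  rewrite mem_enum => ij -> xs; eexists; last exact: xs.
  apply/mapP; exists (i : nat, j : nat); last exact: quadE.
  by rewrite (mem_pairs _ ltn) !ltn_ord !andbT.
rewrite (mem_pairs _ ltn) => /and3P[ij lt_i lt_j] sE xs.
rewrite (etrans sE (esym (quadE (Ordinal lt_i) (Ordinal lt_j)))) in xs; eexists; last exact: xs.
by apply/mapP; exists (Ordinal lt_i, Ordinal lt_j); rewrite ?mem_enum.
Qed.

Fixpoint bools k : seq bitseq :=
  if k is k'.+1 then [seq b :: t | b <- [:: true; false], t <- bools k'] else [:: [::]].

Lemma mem_bools k t : (t \in bools k) = (size t == k).
Proof.
elim: k t => [|k IHk] [|b t] //; first by apply/allpairsP => -[[b t] []].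
rewrite eqSS -IHk; apply/allpairsP/idP => [[[b' t'] /= [_ t'k [_ ->]]] //|tk].
by exists (b, t); split=> //; case: b.
Qed.

Definition half_spin_rows : seq (seq int) :=
  [seq [seq if b then -1 else 1 | b : bool <- t] | t <- bools 8 & ~~ odd (count id t)].

Definition rowsE8 := rowsD 8 ++ half_spin_rows.

Lemma rsE8_rows : rsE8 R =i map half_row rowsE8.
Proof.
pose signs (s : {ffun 'I_8 -> bool}) : bitseq := [seq s i | i <- enum 'I_8].
have size_signs s : size (signs s) = 8%N by rewrite size_map size_enum_ord.
have nth_signs (s : {ffun 'I_8 -> bool}) (i : 'I_8) : nth false (signs s) i = s i.
  by rewrite (nth_map i) ?size_enum_ord // nth_ord_enum.
have count_signs (s : {ffun 'I_8 -> bool}) : #|[pred i | s i]| = count id (signs s).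
  by rewrite count_map -sum1_card -sum1_count big_enum_cond; apply: eq_bigl.
have rowE (s : {ffun 'I_8 -> bool}) : half_row [seq if b then -1 else 1 | b : bool <- signs s] =
    \row_i (if s i then - 2^-1 else 2^-1) :> 'rV[R]_8.
  apply/rowP => i; rewrite !mxE (nth_map false) ?size_signs // nth_signs.
  by case: (s i); rewrite ?mul1r ?rmorphN ?mulN1r.
have signsK t : size t = 8%N -> signs [ffun i : 'I_8 => nth false t i] = t.
  move=> size_t; apply: (@eq_from_nth _ false); rewrite size_signs // => i lt_i.
  by rewrite (nth_signs _ (Ordinal lt_i)) ffunE.
move=> x; rewrite /rowsE8 map_cat !mem_cat rsD_rows; congr (_ || _); rewrite -map_comp.
apply/mapP/mapP => [[s]|[t]].
  rewrite mem_enum => even_s ->; exists (signs s); last by rewrite /= rowE.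
  by rewrite mem_filter mem_bools size_signs -count_signs eqxx andbT.
rewrite mem_filter mem_bools => /andP[even_t /eqP size_t] ->.
exists [ffun i : 'I_8 => nth false t i]; last by rewrite -rowE signsK.
by rewrite mem_enum inE count_signs signsK.
Qed.

Lemma halfones_half_row : halfones R = half_row (nseq 8 1).
Proof. by apply/rowP => i; rewrite !mxE nth_nseq ltn_ord mul1r. Qed.

Lemma a2vec_half_row : a2vec R = half_row [:: 2; 2; 0; 0; 0; 0; 0; 0].
Proof.
by rewrite /a2vec -[ev R 0]scale1r -[ev R 1]scale1r -!(half_row_unit _ 1) -half_row_add.
Qed.

Definition rowsE7 := [seq l <- rowsE8 | idot l (nseq 8 1) == 0].
Definition rowsE6 := [seq l <- rowsE7 | idot l [:: 2; 2; 0; 0; 0; 0; 0; 0] == 0].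

Lemma rsE7_rows : rsE7 R =i map half_row rowsE7.
Proof. by rewrite /rsE7 halfones_half_row; apply: filter_orth_rows rsE8_rows. Qed.

Lemma rsE6_rows : rsE6 R =i map half_row rowsE6.
Proof.
have orthE := @filter_orth_rows R 8 _ _ [:: 2; 2; 0; 0; 0; 0; 0; 0] isT rsE7_rows.
move=> x; rewrite -{}orthE -a2vec_half_row -filter_predI; congr (_ \in _).
by apply: eq_filter => y; rewrite /= andbC.
Qed.

Lemma osum_rows a b (S : seq 'rV[R]_a) (T : seq 'rV[R]_b) (L L' : seq (seq int)) :
  all (fun l => size l == a) L -> S =i map half_row L -> T =i map half_row L' ->
  osum S T =i map half_row ([seq l ++ nseq b 0 | l <- L] ++ [seq nseq a 0 ++ l | l <- L']).
Proof.
move=> /allP size_L SE TE x.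
have row_mx0E l : l \in L -> row_mx (half_row l) 0 = half_row (l ++ nseq b 0) :> 'rV[R]_(a + b).
  move=> /size_L/eqP size_l; apply/rowP => i; rewrite !mxE nth_cat size_l.
  case: splitP => j ->; rewrite !mxE ?ltn_ord //.
  by rewrite nth_nseq if_same mul0r.
have row_0mxE l : row_mx 0 (half_row l) = half_row (nseq a 0 ++ l) :> 'rV[R]_(a + b).
  apply/rowP => i; rewrite !mxE nth_cat size_nseq.
  case: splitP => j ->; rewrite !mxE ?ltn_ord ?nth_nseq ?ltn_ord ?mul0r //.
  by rewrite addKn.
rewrite map_cat !mem_cat -!map_comp; congr (_ || _); apply/mapP/mapP => [[y]|[l lL ->]].
- by rewrite SE => /mapP[l lL ->] ->; exists l; rewrite //= row_mx0E.
- by exists (half_row l); rewrite ?SE ?map_f //= row_mx0E.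
- by rewrite TE => /mapP[l lL ->] ->; exists l; rewrite //= row_0mxE.
- by exists (half_row l); rewrite ?TE ?map_f //= row_0mxE.
Qed.

End StandardRows.

Definition gramA1 : seq (seq int) := [:: [:: 2]].
Definition gramA2 : seq (seq int) := [:: [:: 2; -1]; [:: -1; 2]].

Definition baseD k : seq (seq int) :=
  rcons [seq add_row k (unit_row k i 1) (unit_row k i.+1 (-1)) | i <- iota 0 k.-1]
        (add_row k (unit_row k k.-2 1) (unit_row k k.-1 1)).

Definition gramD k : seq (seq int) := [seq [seq idot x y | x <- baseD k] | y <- baseD k].

Definition doubled_baseE8 : seq (seq int) :=
  [:: [:: 1; -1; -1; -1; -1; -1; -1; 1];
      [:: 2; 2; 0; 0; 0; 0; 0; 0];
      [:: -2; 2; 0; 0; 0; 0; 0; 0];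
      [:: 0; -2; 2; 0; 0; 0; 0; 0];
      [:: 0; 0; -2; 2; 0; 0; 0; 0];
      [:: 0; 0; 0; -2; 2; 0; 0; 0];
      [:: 0; 0; 0; 0; -2; 2; 0; 0];
      [:: 0; 0; 0; 0; 0; -2; 2; 0]].

Definition doubled_baseE7 : seq (seq int) :=
  [:: [:: 0; 0; 0; 0; 0; 0; 2; -2];
      [:: 1; -1; -1; -1; -1; 1; 1; 1];
      [:: 0; 0; 0; 0; 0; 2; -2; 0];
      [:: 0; 0; 0; 0; 2; -2; 0; 0];
      [:: 0; 0; 0; 2; -2; 0; 0; 0];
      [:: 0; 0; 2; -2; 0; 0; 0; 0];
      [:: 0; 2; -2; 0; 0; 0; 0; 0]].

Definition doubled_baseE6 : seq (seq int) :=
  [:: [:: 0; 0; 2; -2; 0; 0; 0; 0];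
      [:: 1; -1; -1; -1; -1; 1; 1; 1];
      [:: 0; 0; 0; 2; -2; 0; 0; 0];
      [:: 0; 0; 0; 0; 2; -2; 0; 0];
      [:: 0; 0; 0; 0; 0; 2; -2; 0];
      [:: 0; 0; 0; 0; 0; 0; 2; -2]].

Section Models.
Variable R : realType.

Lemma modelled_A1 : modelled (rsA R 1) gramA1 2.
Proof. by apply: (modelled_rows (B := [:: [:: 2; -2]]) (@rsA_rows R 1)); vm_compute. Qed.

Lemma modelled_A2 : modelled (rsA R 2) gramA2 3.
Proof.
by apply: (modelled_rows (B := [:: [:: 2; -2; 0]; [:: 0; 2; -2]]) (@rsA_rows R 2)); vm_compute.
Qed.

Lemma modelled_A1A1 : modelled (osum (rsA R 1) (rsA R 1)) (gram_sum gramA1 gramA1) 2.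
Proof.
have size_A1 : all (fun l => size l == 2%N) (rowsA 1) by [].
have A1A1_rows := osum_rows size_A1 (@rsA_rows R 1) (@rsA_rows R 1).
by apply: (modelled_rows (B := [:: [:: 2; -2; 0; 0]; [:: 0; 0; 2; -2]]) A1A1_rows); vm_compute.
Qed.

Lemma modelled_D4 : modelled (rsD R 4) (gramD 4) 6.
Proof.
apply: (modelled_rows (B := [seq map ( *%R 2) l | l <- baseD 4]) (@rsD_rows R 4)).
by vm_compute.
Qed.

Lemma modelled_D16 : modelled (rsD R 16) (gramD 16) 30.
Proof.
apply: (modelled_rows (B := [seq map ( *%R 2) l | l <- baseD 16]) (@rsD_rows R 16)).
by vm_compute.
Qed.

Lemma modelled_E6 : modelled (rsE6 R) gramE6 12.
Proof. by apply: (modelled_rows (B := doubled_baseE6) (@rsE6_rows R)); vm_compute. Qed.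

Lemma modelled_E7 : modelled (rsE7 R) gramE7 18.
Proof. by apply: (modelled_rows (B := doubled_baseE7) (@rsE7_rows R)); vm_compute. Qed.

Lemma modelled_E8 : modelled (rsE8 R) gramE8 30.
Proof. by apply: (modelled_rows (B := doubled_baseE8) (@rsE8_rows R)); vm_compute. Qed.

Lemma modelled_E8E8 : modelled (osum (rsE8 R) (rsE8 R)) (gram_sum gramE8 gramE8) 30.
Proof.
have size_E8 : all (fun l => size l == 8%N) rowsE8 by vm_compute.
have E8E8_rows := osum_rows size_E8 (@rsE8_rows R) (@rsE8_rows R).
apply: (modelled_rows (B := gram_sum doubled_baseE8 doubled_baseE8) E8E8_rows).
by vm_compute.
Qed.

End Models.

(** * Identification of the root systems *)

Section SubsystemBases.
Variables (R : realType) (n : nat) (Phi : seq 'rV[R]_n).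
Hypothesis slPhi : simply_laced Phi.
Implicit Types (a r v : 'rV[R]_n) (b e : seq 'rV[R]_n) (G : seq (seq int)).

Lemma Dframe_has_base e : Dframe Phi e -> (1 < size e)%N -> has_base Phi (gramD (size e)).
Proof.
move=> De size_e; set k := size e; have [on_e _] := De.
exists [seq lincomb e l | l <- baseD k]; last first.
  apply: has_gram_lincomb => //; rewrite all_rcons /= size_map size_iota leqnn /=.
  by apply/allP => _ /mapP[i _ ->]; rewrite size_map size_iota.
move=> _ /mapP[l lB ->]; move: lB; rewrite mem_rcons inE => /orP[/eqP->|/mapP[i]].
  rewrite lincomb_add_row !lincomb_unit_row ?scale1r; try lia.
  by have [|||] := @Dframe_nth _ _ _ e k.-2 k.-1 De; try lia.
rewrite mem_iota => lt_i ->; rewrite lincomb_add_row !lincomb_unit_row; try lia.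
rewrite scale1r scaleN1r.
by have [|||] := @Dframe_nth _ _ _ e i i.+1 De; try lia.
Qed.

Definition orth_roots b := [seq r <- Phi | orth_all b r].

Lemma orth_rootsP b r :
  reflect (r \in Phi /\ {in b, forall y, dotv r y = 0}) (r \in orth_roots b).
Proof. by rewrite mem_filter; apply: (iffP andP) => -[] => [/orth_allP|? /orth_allP]. Qed.

Lemma simply_laced_orth_roots b : simply_laced (orth_roots b).
Proof.
have sub r : r \in orth_roots b -> r \in Phi by case/orth_rootsP.
have [[uniqPhi notin0 closed int_dot] norm2Phi] := slPhi.
split; last by move=> r /sub; exact: norm2Phi.
split; [exact: filter_uniq| |move=> x y|by move=> x y /sub xP /sub; exact: int_dot].
  by apply: contra notin0; exact: sub.
move=> /orth_rootsP[xP x_orth] /orth_rootsP[yP y_orth]; apply/orth_rootsP; split.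
  exact: closed.
by move=> z zb; rewrite /refl dotvBl dotvZl (x_orth z) // (y_orth z) // mulr0 subr0.
Qed.

Lemma splits_mem b G k r : splits Phi b G k -> r \in Phi ->
  (r \in subsystem b G k) || (r \in orth_roots b).
Proof. by move=> /allP split_b rP; rewrite mem_filter rP andbT; exact: split_b. Qed.

Lemma dotv_subsystem_orth_roots b G k : size G = size b ->
  {in subsystem b G k & orth_roots b, forall x y, dotv x y = 0}.
Proof.
move=> size_G _ y /mapP[c _ ->] /orth_rootsP[_ y_orth]; rewrite dotv_lincomb big1 // => i _.
by rewrite dotvC y_orth ?mulr0 ?mem_nth.
Qed.

Lemma coxeter_regular_orth_roots b G k h : size G = size b -> splits Phi b G k ->
  coxeter_regular Phi h -> coxeter_regular (orth_roots b) h.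
Proof.
move=> size_G split_b regPhi a aQ; have [aP a_orth] := orth_rootsP _ _ aQ.
rewrite -(regPhi a aP); congr (_ + _)%N; rewrite /valency count_filter.
apply: eq_in_count => r rP /=; case: eqP => //= ra.
case/orP: (splits_mem split_b rP) => [rS|]; last by rewrite mem_filter => /andP[].
have := dotv_subsystem_orth_roots size_G rS aQ.
by rewrite ra => /eqP; rewrite oner_eq0.
Qed.

Lemma Dframe_orth_eq0 b e v : Dframe (orth_roots b) e -> (1 < size e)%N -> size e = n ->
  v \in b -> v = 0.
Proof.
move=> De size_gt1 size_e vb; have [[uniq_e _] rootD] := De.
apply: (orthonormal_full De.1 size_e) => x xe.
have [y ye yx] := exists_neq_mem x uniq_e size_gt1.
have [] := rootD x y xe ye ltac:(by rewrite eq_sym).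
move=> /orth_rootsP[_ /(_ v vb) + ] /orth_rootsP[_ /(_ v vb)].
by rewrite dotvBl dotvDl ![dotv _ v]dotvC; lra.
Qed.

End SubsystemBases.

Section StandardSystems.
Variables (R : realType) (n : nat) (Phi : seq 'rV[R]_n) (h : nat).
Hypotheses (slPhi : simply_laced Phi) (spPhi : spans Phi) (Phi_neq0 : Phi != [::]).
Hypotheses (regPhi : coxeter_regular Phi h) (sizePhi : size Phi = (n * h)%N).

Lemma has_base_A1 : has_base Phi gramA1.
Proof.
have [a aP] := exists_mem Phi_neq0; exists [:: a]; first by move=> x; rewrite inE => /eqP->.
by split=> // -[|i] [|j] // _ _; rewrite /= (root_norm2 slPhi).
Qed.

Lemma has_base_A2 : h = 3%N -> has_base Phi gramA2.
Proof.
move=> h3; have [a aP] := exists_mem Phi_neq0.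
have /hasP[x xP /eqP xa] : has (fun x => dotv x a == 1) Phi.
  by have := regPhi aP; rewrite has_count /valency; lia.
have ab : dotv a (- x) = -1 by rewrite dotvNr dotvC xa.
exists [:: a; - x].
  by move=> z; rewrite !inE => /orP[]/eqP->; rewrite ?(root_oppE slPhi).
split=> // -[|[|i]] [|[|j]] // _ _; rewrite /= ?(root_norm2 slPhi) ?(root_oppE slPhi) //.
by rewrite dotvC.
Qed.

Lemma has_base_A1A1 : n = 2%N -> h = 2%N -> has_base Phi (gram_sum gramA1 gramA1).
Proof.
move=> n2 h2; have [a aP] := exists_mem Phi_neq0.
have not_adjacent x y : x \in Phi -> y \in Phi -> dotv x y != 1.
  move=> xP yP; suff /hasPn : ~~ has (fun x => dotv x y == 1) Phi by apply.
  by rewrite has_count -/(valency Phi y); have := regPhi yP; lia.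
have [b bP b_notin] : exists2 b, b \in Phi & b \notin [:: a; - a].
  apply/hasP; rewrite has_predC; apply/negP => /allP sub.
  by have /= := uniq_leq_size (simply_laced_uniq slPhi) sub; rewrite sizePhi; lia.
have ab : dotv a b = 0.
  have ab_neq1 := not_adjacent a b aP bP.
  have ab_neqN1 : dotv a b != -1.
    by have := not_adjacent (- a) b; rewrite (root_oppE slPhi) dotvNl eqr_oppLR; apply.
  case: (root_dotP slPhi aP bP) ab_neq1 ab_neqN1 => [aE|aE|||]; rewrite ?eqxx // => _ _.
    by rewrite aE mem_head in b_notin.
  by rewrite aE opprK !inE eqxx orbT in b_notin.
exists [:: a; b]; first by move=> x; rewrite !inE => /orP[]/eqP->.
split=> // -[|[|i]] [|[|j]] // _ _; rewrite /= ?(root_norm2 slPhi) //.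
by rewrite dotvC.
Qed.

Lemma has_base_D4 : n = 4%N -> h = 6%N -> has_base Phi (gramD 4).
Proof.
move=> n4 h6; have [|[e [De _ hE]]|[]|[]|[]] := coxeter_classification slPhi regPhi _ Phi_neq0;
  rewrite ?n4 ?h6 //.
have size_e : size e = 4%N by lia.
by rewrite -size_e; apply: Dframe_has_base; rewrite ?size_e.
Qed.

Lemma has_base_E6 : n = 6%N -> h = 12%N -> has_base Phi gramE6.
Proof.
move=> nE hE; have [||[]|[]|[]] := exceptional_classification slPhi regPhi _ _ Phi_neq0;
by rewrite ?nE ?hE.
Qed.

Lemma has_base_E7 : n = 7%N -> h = 18%N -> has_base Phi gramE7.
Proof.
move=> nE hE; have [||[]|[]|[]] := exceptional_classification slPhi regPhi _ _ Phi_neq0;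
by rewrite ?nE ?hE.
Qed.

Lemma has_base_E8 : n = 8%N -> h = 30%N -> has_base Phi gramE8.
Proof.
move=> nE hE; have [||[]|[]|[]] := exceptional_classification slPhi regPhi _ _ Phi_neq0;
by rewrite ?nE ?hE.
Qed.

(* The roots orthogonal to a subsystem E8 form a second one: they cannot contain an
   orthonormal frame of full size. *)
Lemma has_base_E8E8 : n = 16%N -> h = 30%N -> has_base Phi gramE8 ->
  has_base Phi (gram_sum gramE8 gramE8).
Proof.
move=> n16 h30 [b subb gram_b]; have [size_b _ _] := gram_b.
have split_b := E8_splits slPhi subb gram_b.
have slQ := simply_laced_orth_roots slPhi b.
have regQ := coxeter_regular_orth_roots size_b split_b regPhi.
have Q_neq0 : orth_roots Phi b != [::].
  apply/eqP => Q0; have sub : {subset Phi <= subsystem b gramE8 30}.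
    by move=> r rP; have := splits_mem split_b rP; rewrite Q0 orbF.
  have := uniq_leq_size (simply_laced_uniq slPhi) sub.
  by rewrite (size_subsystem gram_b gramE8_ok) sizePhi -size_b n16 h30.
have [|[e [De _ hE]]|[]|[]|[_ [b' subb' gram_b']]] := coxeter_classification slQ regQ _ Q_neq0;
  rewrite ?n16 ?h30 //.
  have b0b : b`_0 \in b by rewrite mem_nth // -size_b.
  have b0 : b`_0 = 0 by apply: (Dframe_orth_eq0 De) b0b; lia.
  by have := simply_laced_neq0 slPhi (subb _ b0b); rewrite b0 eqxx.
exists (b ++ b').
  by move=> x; rewrite mem_cat => /orP[/subb//|/subb'/orth_rootsP[]].
apply: has_gram_cat => // x y xb /subb'/orth_rootsP[_ y_orth].
by rewrite dotvC y_orth.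
Qed.

Let equiv_parameters := rs_equiv_modelled slPhi spPhi regPhi sizePhi.

Lemma rs_equiv_A1 : rs_equiv Phi (rsA R 1) <-> (n, h) = (1, 2)%N.
Proof. by apply: (equiv_parameters (modelled_A1 R)) => _ _; exact: has_base_A1. Qed.

Lemma rs_equiv_A2 : rs_equiv Phi (rsA R 2) <-> (n, h) = (2, 3)%N.
Proof. by apply: (equiv_parameters (modelled_A2 R)) => _; exact: has_base_A2. Qed.

Lemma rs_equiv_A1A1 : rs_equiv Phi (osum (rsA R 1) (rsA R 1)) <-> (n, h) = (2, 2)%N.
Proof. exact: (equiv_parameters (modelled_A1A1 R)) has_base_A1A1. Qed.

Lemma rs_equiv_D4 : rs_equiv Phi (rsD R 4) <-> (n, h) = (4, 6)%N.
Proof. exact: (equiv_parameters (modelled_D4 R)) has_base_D4. Qed.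

Lemma rs_equiv_E6 : rs_equiv Phi (rsE6 R) <-> (n, h) = (6, 12)%N.
Proof. exact: (equiv_parameters (modelled_E6 R)) has_base_E6. Qed.

Lemma rs_equiv_E7 : rs_equiv Phi (rsE7 R) <-> (n, h) = (7, 18)%N.
Proof. exact: (equiv_parameters (modelled_E7 R)) has_base_E7. Qed.

Lemma rs_equiv_E8 : rs_equiv Phi (rsE8 R) <-> (n, h) = (8, 30)%N.
Proof. exact: (equiv_parameters (modelled_E8 R)) has_base_E8. Qed.

Lemma rs_equiv_E8E8_or_D16 :
  rs_equiv Phi (osum (rsE8 R) (rsE8 R)) \/ rs_equiv Phi (rsD R 16) <-> (n, h) = (16, 30)%N.
Proof.
have parameters := modelled_parameters slPhi regPhi sizePhi.
split=> [|[n16 h30]].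
  by case=> [/(parameters _ _ _ _ (modelled_E8E8 R))|/(parameters _ _ _ _ (modelled_D16 R))][-> ->].
have sizePhi30 : size Phi = (n * 30)%N by rewrite sizePhi h30.
have [|[e [De _ hE]]|[]|[]|[_ E8]] := coxeter_classification slPhi regPhi _ Phi_neq0;
  rewrite ?n16 ?h30 //; [right|left].
  have size_e : size e = 16%N by lia.
  apply: (has_base_rs_equiv slPhi spPhi sizePhi30 (modelled_D16 R) (esym n16)).
  by rewrite -size_e; apply: Dframe_has_base; rewrite ?size_e.
exact/(has_base_rs_equiv slPhi spPhi sizePhi30 (modelled_E8E8 R) (esym n16))/has_base_E8E8.
Qed.

End StandardSystems.

Theorem proposition8p5 (R : realType) (n : nat) (Phi : seq 'rV[R]_n) :
  root_system Phi -> Phi != [::] -> norm2 Phi -> strongly_eutactic Phi ->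
  spans Phi ->
  (* (i) *)
  design_cond Phi 2 /\
  [/\ (* (ii) *)
      design_cond Phi 4 <->
        (rs_equiv Phi (rsA R 1) \/ rs_equiv Phi (rsA R 2) \/
         rs_equiv Phi (rsD R 4) \/ rs_equiv Phi (rsE6 R) \/
         rs_equiv Phi (rsE7 R) \/ rs_equiv Phi (rsE8 R)),
      (* (iii) *)
      design_cond Phi 6 <->
        (rs_equiv Phi (rsA R 1) \/ rs_equiv Phi (osum (rsA R 1) (rsA R 1))  \/
            rs_equiv Phi (rsE8 R) \/ rs_equiv Phi (osum (rsE8 R) (rsE8 R))
          \/ rs_equiv Phi (rsD R 16)),
      (* (iv) *)
      design_cond Phi 8 <-> (rs_equiv Phi (rsA R 1) \/ rs_equiv Phi (rsA R 2)),
      (* (v) *)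
      design_cond Phi 10 <->
        (rs_equiv Phi (rsA R 1) \/ rs_equiv Phi (osum (rsA R 1) (rsA R 1))  \/
            rs_equiv Phi (rsA R 2) \/ rs_equiv Phi (rsD R 4)
          \/ rs_equiv Phi (rsE8 R))
    & (* (vi) *)
      design_cond Phi 12 <-> rs_equiv Phi (rsA R 1)].
Proof.
move=> rootPhi Phi_neq0 norm2Phi eutPhi spPhi; have slPhi := conj rootPhi norm2Phi.
have [h regPhi sizePhi] := strongly_eutactic_coxeter slPhi eutPhi spPhi Phi_neq0.
have adm := coxeter_admissible slPhi regPhi Phi_neq0.
have designE := design_cond_parameters slPhi Phi_neq0 regPhi sizePhi adm.
split; first exact/(design_cond_poly slPhi Phi_neq0 regPhi sizePhi adm (j := 1)).
have equivA1 := rs_equiv_A1 slPhi spPhi Phi_neq0 regPhi sizePhi.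
have equivA2 := rs_equiv_A2 slPhi spPhi Phi_neq0 regPhi sizePhi.
have equivA1A1 := rs_equiv_A1A1 slPhi spPhi Phi_neq0 regPhi sizePhi.
have equivD4 := rs_equiv_D4 slPhi spPhi Phi_neq0 regPhi sizePhi.
have equivE6 := rs_equiv_E6 slPhi spPhi Phi_neq0 regPhi sizePhi.
have equivE7 := rs_equiv_E7 slPhi spPhi Phi_neq0 regPhi sizePhi.
have equivE8 := rs_equiv_E8 slPhi spPhi Phi_neq0 regPhi sizePhi.
have equiv_rank16 := rs_equiv_E8E8_or_D16 slPhi spPhi Phi_neq0 regPhi sizePhi.
split; rewrite ?equiv_rank16 ?equivA1 ?equivA2 ?equivA1A1 ?equivD4 ?equivE6 ?equivE7 ?equivE8;
  [rewrite (designE 2%N)|rewrite (designE 3%N)|rewrite (designE 4%N)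
  |rewrite (designE 5%N)|rewrite (designE 6%N)] => //;
by rewrite !inE -?(rwP orP) -!(rwP eqP).
Qed.
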